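(* Let $1 \leq p < \infty$. Then the Banach space $L_p \cap L_\infty$ (of functions on $(0,\infty)$ with Lebesgue measure) contains a complemented subspace isomorphic to the space $l_2$ if and only if $p = 2$.
   Context: All functions are real-valued Lebesgue measurable functions on $(0,\infty)$, identified when equal almost everywhere; $L_p = L_p(0,\infty)$ and $L_\infty = L_\infty(0,\infty)$ with respect to Lebesgue measure. The space $L_p \cap L_\infty$ consists of all functions lying in both $L_p$ and $L_\infty$, with the norm $\|x\|_{L_p\cap L_\infty} = \max\{\|x\|_{L_p}, \|x\|_{L_\infty}\}$. The space $l_2$ is the Banach space of square-summable real sequences. A closed subspace of a Banach space $X$ is complemented if it is the range of a bounded linear projection on $X$. Isomorphic means linearly homeomorphic. *)

(* Defs.v *)
From HB Require Import structures.
From mathcomp Require Import all_boot all_order all_algebra.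
From mathcomp Require Import all_classical all_reals all_analysis.
From mathcomp Require Import measurable_realfun ess_sup_inf.
Import Order.TTheory GRing.Theory Num.Theory.
Import numFieldNormedType.Exports.
Set Implicit Arguments.
Unset Strict Implicit.
Unset Printing Implicit Defensive.
Local Open Scope classical_set_scope.
Local Open Scope ring_scope.
Local Open Scope quotient_scope.

Section ae_classes.
Context d (T : measurableType d) (R : realType).
Variable mu : {measure set T -> \bar R}.
Local Notation L0 := {mfun_ mu, T >-> R}.
Implicit Types (f g : {mfun T >-> R}) (x y z : L0).

Lemma pi_aeP f g : \pi_L0 f = \pi_L0 g <-> f = g %[ae mu].
Proof.
split => [/eqP|fg]; first by rewrite eqmodE => /asboolP.
by apply/eqP; rewrite eqmodE; exact/asboolP.
Qed.

Lemma ae_repr_pi f : repr (\pi_L0 f) = f %[ae mu].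
Proof. by apply/pi_aeP; rewrite reprK. Qed.

Definition ae_zero : L0 := \pi_L0 (0 : {mfun T >-> R}).
Definition ae_opp x : L0 := \pi_L0 (- repr x).
Definition ae_add x y : L0 := \pi_L0 (repr x + repr y).
Definition ae_scale (a : R) x : L0 := \pi_L0 (a *: repr x : {mfun T >-> R}).

Lemma pi_oppE f : ae_opp (\pi_L0 f) = \pi_L0 (- f).
Proof.
apply/pi_aeP; apply: filterS (ae_repr_pi f) => t /= e tD.
exact: congr1 (e tD).
Qed.

Lemma pi_addE f g : ae_add (\pi_L0 f) (\pi_L0 g) = \pi_L0 (f + g).
Proof.
apply/pi_aeP; apply: filterS2 (ae_repr_pi f) (ae_repr_pi g) => t /= e1 e2 tD.
exact: congr2 (e1 tD) (e2 tD).
Qed.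

Lemma pi_scaleE a f : ae_scale a (\pi_L0 f) = \pi_L0 (a *: f : {mfun T >-> R}).
Proof.
apply/pi_aeP; apply: filterS (ae_repr_pi f) => t /= e tD.
exact: (congr1 ( *%R a) (e tD)).
Qed.

Lemma ae_addA : associative ae_add.
Proof.
elim/quotW=> f; elim/quotW=> g; elim/quotW=> h.
by rewrite (pi_addE g h) (pi_addE f g) (pi_addE f) (pi_addE (f + g)) addrA.
Qed.

Lemma ae_addC : commutative ae_add.
Proof.
by elim/quotW=> f; elim/quotW=> g; rewrite (pi_addE f g) (pi_addE g f) addrC.
Qed.

Lemma ae_add0 : left_id ae_zero ae_add.
Proof. by elim/quotW=> f; rewrite (pi_addE 0 f) add0r. Qed.

Lemma ae_addN : left_inverse ae_zero ae_opp ae_add.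
Proof. by elim/quotW=> f; rewrite (pi_oppE f) (pi_addE (- f) f) addNr. Qed.

HB.instance Definition _ :=
  GRing.isZmodule.Build L0 ae_addA ae_addC ae_add0 ae_addN.

Lemma ae_scaleA a b x : ae_scale a (ae_scale b x) = ae_scale (a * b) x.
Proof.
elim/quotW: x => f.
by rewrite (pi_scaleE b f) (pi_scaleE a) (pi_scaleE (a * b) f) scalerA.
Qed.

Lemma ae_scale1 : left_id 1 ae_scale.
Proof. by elim/quotW=> f; rewrite (pi_scaleE 1 f) scale1r. Qed.

Lemma ae_scaleDr : right_distributive ae_scale +%R.
Proof.
move=> a; elim/quotW=> f; elim/quotW=> g.
rewrite -[LHS]/(ae_scale a (ae_add (\pi_L0 f) (\pi_L0 g))).
rewrite -[RHS]/(ae_add (ae_scale a (\pi_L0 f)) (ae_scale a (\pi_L0 g))).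
rewrite (pi_addE f g) (pi_scaleE a (f + g)) (pi_scaleE a f) (pi_scaleE a g).
by rewrite (pi_addE (a *: f) (a *: g)) scalerDr.
Qed.

Lemma ae_scaleDl x : {morph ae_scale^~ x : a b / a + b}.
Proof.
move=> a b /=; elim/quotW: x => f.
rewrite -[RHS]/(ae_add (ae_scale a (\pi_L0 f)) (ae_scale b (\pi_L0 f))).
rewrite (pi_scaleE (a + b) f) (pi_scaleE a f) (pi_scaleE b f).
by rewrite (pi_addE (a *: f) (b *: f)) scalerDl.
Qed.

HB.instance Definition _ := GRing.Zmodule_isLmodule.Build R L0
  ae_scaleA ae_scale1 ae_scaleDr ae_scaleDl.

Lemma ae_class0 : (0 : L0) = cst 0 %[ae mu].
Proof. exact: (ae_repr_pi (0 : {mfun T >-> R})). Qed.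

Lemma ae_classD x y : (x + y : L0) = x \+ y %[ae mu].
Proof. exact: (ae_repr_pi (repr x + repr y)). Qed.

Lemma ae_classZ a x : (a *: x : L0) = a \*: (x : T -> R) %[ae mu].
Proof. exact: (ae_repr_pi (a *: repr x : {mfun T >-> R})). Qed.

Lemma ae_class_measurable x : measurable_fun setT (x : T -> R).
Proof. by case: (repr x) => f [[]]. Qed.

Lemma ae_class_eq x y : x = y %[ae mu] -> x = y.
Proof. by move=> xy; rewrite -[x]reprK -[y]reprK; apply/pi_aeP. Qed.

End ae_classes.

Section Lnorm_ae.
Context d (T : measurableType d) (R : realType).
Variables (mu : {measure set T -> \bar R}) (p : \bar R) (p1 : (1 <= p)%E).
Local Notation L0 := {mfun_ mu, T >-> R}.
Local Notation N f := ('N[mu]_p[EFin \o f%R])%E.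
Implicit Types (x y : L0).

Lemma eq_ae_Lnorm (f g : T -> R) : measurable_fun setT f ->
  measurable_fun setT g -> f = g %[ae mu] -> N f = N g.
Proof.
move=> mf mg fg; rewrite unlock /Lnorm; case: p p1 => [r _|_|]//.
- congr (_ `^ _)%E; apply: ae_eq_integral => //.
  + apply: (measurableT_comp (measurable_poweR r)).
    by apply: measurableT_comp => //; apply: measurableT_comp.
  + apply: (measurableT_comp (measurable_poweR r)).
    by apply: measurableT_comp => //; apply: measurableT_comp.
  + by apply: filterS fg => t /= e tD; rewrite (e tD).
- case: ifP => // _; apply: eq_ess_sup.
  by apply: filterS fg => t /= e; rewrite (e Logic.I).
Qed.

Lemma Lnorm_class0 : N (0 : L0) = 0%E.
Proof.
rewrite (@eq_ae_Lnorm _ (cst 0)); [|exact: ae_class_measurable|by []|].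
- by rewrite Lnorm0// gt_eqF// (lt_le_trans _ p1).
- exact: ae_class0.
Qed.

Lemma Lnorm_classD x y : (N (x + y : L0) <= N x + N y)%E.
Proof.
rewrite (@eq_ae_Lnorm _ (x \+ y)); [|exact: ae_class_measurable| |].
- by apply: eminkowski => //; exact: ae_class_measurable.
- by apply: measurable_funD; exact: ae_class_measurable.
- exact: ae_classD.
Qed.

Lemma Lnorm_classZ a x : finite_norm mu p x ->
  N (a *: x : L0) = (`|a|%:E * N x)%E.
Proof.
move=> fx.
have xL : (x : T -> R) \in Lfun mu p.
  by rewrite inE; apply/andP; split; apply: mem_set => //;
    exact: ae_class_measurable.
rewrite (@eq_ae_Lnorm _ (a \*: (x : T -> R))).
- exact: (LnormZ (Lfun_Sub p1 xL) a).
- exact: ae_class_measurable.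
- by apply: measurable_funM => //; exact: ae_class_measurable.
- exact: ae_classZ.
Qed.

Lemma finite_norm_fin_num x : finite_norm mu p x -> N x \is a fin_num.
Proof. by move=> fx; rewrite ge0_fin_numE// Lnorm_ge0. Qed.

End Lnorm_ae.

Section Lp_cap_Loo.
Context d (T : measurableType d) (R : realType).
Variables (mu : {measure set T -> \bar R}) (p : R) (p1 : 1 <= p).
Local Notation L0 := {mfun_ mu, T >-> R}.

(* The exponent hypothesis is an argument of the predicate and of the type so
   that the module and norm structures below can be inferred from the type. *)
Definition Lp_cap_Loo_pred of 1 <= p : {pred L0} :=
  mem [set x : L0 | finite_norm mu p%:E x /\ finite_norm mu +oo%E x].
Local Notation pr := (Lp_cap_Loo_pred p1).

Let p1E : (1 <= p%:E)%E. Proof. by rewrite lee_fin. Qed.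
Let oo1 : (1 <= +oo :> \bar R)%E. Proof. exact: leey. Qed.

Lemma Lp_cap_Loo_submod_closed : submod_closed pr.
Proof.
split; first by rewrite inE /= /finite_norm !Lnorm_class0.
move=> a + +; change (forall x y : L0, x \in pr -> y \in pr -> a *: x + y \in pr).
move=> x y; rewrite !inE /= => -[xp xoo] [yp yoo].
have H q : (1 <= q)%E -> finite_norm mu q x -> finite_norm mu q y ->
    finite_norm mu q (a *: x + y : L0).
  move=> q1 xq yq; rewrite /finite_norm.
  apply: le_lt_trans (Lnorm_classD q1 (a *: x) y) _.
  by rewrite lte_add_pinfty// Lnorm_classZ// lte_mul_pinfty.
by split; exact: H.
Qed.

HB.instance Definition _ :=
  GRing.isSubmodClosed.Build R L0 pr Lp_cap_Loo_submod_closed.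

Record Lp_cap_Loo : Type := LpLoo {
  LpLoo_class :> L0 ;
  _ : LpLoo_class \in pr }.

HB.instance Definition _ := [isSub for LpLoo_class].
HB.instance Definition _ := [Choice of Lp_cap_Loo by <:].
HB.instance Definition _ := [SubChoice_isSubLmodule of Lp_cap_Loo by <:].

Definition Lp_cap_Loo_norm (x : Lp_cap_Loo) : R :=
  Num.max (fine 'N[mu]_p%:E[EFin \o x])%E (fine 'N[mu]_+oo[EFin \o x])%E.

Lemma Lp_cap_Loo_finite (x : Lp_cap_Loo) :
  finite_norm mu p%:E x /\ finite_norm mu +oo%E x.
Proof. by case: x => x /=; rewrite inE. Qed.

Lemma Lp_cap_Loo_normD x y :
  Lp_cap_Loo_norm (x + y) <= Lp_cap_Loo_norm x + Lp_cap_Loo_norm y.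
Proof.
have [xp xoo] := Lp_cap_Loo_finite x; have [yp yoo] := Lp_cap_Loo_finite y.
have H q : (1 <= q)%E -> finite_norm mu q x -> finite_norm mu q y ->
    fine 'N[mu]_q[EFin \o ((x + y : Lp_cap_Loo) : L0)] <=
    fine 'N[mu]_q[EFin \o x] + fine 'N[mu]_q[EFin \o y].
  move=> q1 xq yq; rewrite -fineD ?finite_norm_fin_num//.
  rewrite fine_le ?fin_numD ?finite_norm_fin_num//; last exact: Lnorm_classD.
  rewrite /finite_norm; apply: le_lt_trans (Lnorm_classD q1 x y) _.
  by rewrite lte_add_pinfty.
rewrite /Lp_cap_Loo_norm ge_max; apply/andP; split.
- by apply: le_trans (H _ p1E xp yp) _; rewrite lerD// le_max lexx.
- by apply: le_trans (H _ oo1 xoo yoo) _; rewrite lerD// le_max lexx orbT.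
Qed.

Lemma Lp_cap_Loo_normZ (a : R) x :
  Lp_cap_Loo_norm (a *: x) = `|a| * Lp_cap_Loo_norm x.
Proof.
have [xp xoo] := Lp_cap_Loo_finite x.
have H q : (1 <= q)%E -> finite_norm mu q x ->
    fine 'N[mu]_q[EFin \o ((a *: x : Lp_cap_Loo) : L0)] =
    `|a| * fine 'N[mu]_q[EFin \o x].
  move=> q1 xq; rewrite [X in fine X](Lnorm_classZ q1)//.
  by rewrite fineM// finite_norm_fin_num.
by rewrite /Lp_cap_Loo_norm !H// maxr_pMr.
Qed.

Lemma Lp_cap_Loo_norm0_eq0 x : Lp_cap_Loo_norm x = 0 -> x = 0.
Proof.
move=> x0; have [xp _] := Lp_cap_Loo_finite x.
have /(Lnorm_eq0_eq0 _ _) xae : ('N[mu]_p%:E[EFin \o x] = 0)%E.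
  apply/eqP; rewrite eq_le Lnorm_ge0 andbT -[leLHS]fineK.
    by rewrite lee_fin -x0 le_max lexx.
  exact: finite_norm_fin_num.
apply/val_inj/ae_class_eq; apply: filterS2 (xae _ _) (ae_class0 mu).
- by move=> t /= e1 e2 tD; move: (e1 tD) => -[->]; rewrite (e2 tD).
- by apply/measurable_EFinP; exact: ae_class_measurable.
- by rewrite lte_fin (lt_le_trans _ p1).
Qed.

HB.instance Definition _ := Lmodule_isNormed.Build R Lp_cap_Loo
  Lp_cap_Loo_normD Lp_cap_Loo_normZ Lp_cap_Loo_norm0_eq0.

End Lp_cap_Loo.

(* l_2 is L_2 of the counting measure on nat, for which a.e. equality is
   equality; hence sequences rather than classes (cf. Lnorm_counting). *)
Section l2.
Variable R : realType.

Definition l2 : Type := LfunType (@counting nat R) (lee1n 2).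
HB.instance Definition _ := GRing.Lmodule.on l2.

Definition l2_norm (u : l2) : R := fine 'N[@counting nat R]_2[EFin \o u]%E.

Lemma l2_normD u v : l2_norm (u + v) <= l2_norm u + l2_norm v.
Proof. exact: ler_LnormD. Qed.

Lemma l2_normZ (a : R) u : l2_norm (a *: u) = `|a| * l2_norm u.
Proof.
have fu : finite_norm (@counting nat R) 2 u by exact: Lfunction_finite.
have -> : l2_norm (a *: u) = fine (`|a|%:E * 'N[@counting nat R]_2[EFin \o u])%E.
  by congr fine; exact: (LnormZ u a).
by rewrite fineM// ge0_fin_numE ?Lnorm_ge0.
Qed.

Lemma l2_norm0_eq0 u : l2_norm u = 0 -> u = 0.
Proof.
move=> /fine_Lnormr_eq0 [N [_ N0 sub]]; apply/LfuneqP => n.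
apply: contrapT => un0.
have Nn : N n by apply: sub => /= h; exact/un0/h.
move: N0; rewrite /= /counting; case: asboolP => // finN [] /eqP.
rewrite pnatr_eq0 finmap.cardfs_eq0 => /eqP fN0.
by have := in_fset_set finN n; rewrite fN0 (mem_set Nn) finmap.in_fset0.
Qed.

HB.instance Definition _ := Lmodule_isNormed.Build R l2
  l2_normD l2_normZ l2_norm0_eq0.

End l2.

Section lebesgue_Rpos.
Variable R : realType.

Lemma Lebesgue_measurable_Rpos :
  ((wlength (@idfun R))^*%mu).-cara.-measurable (`]0, +oo[%classic : set R).
Proof. by apply: sub_caratheodory; exact: measurable_itv. Qed.

(* Lebesgue measure on the Lebesgue-measurable sets of R, restricted to
   (0, +oo): classes modulo this measure of functions on R are classes modulo
   Lebesgue measure of functions on (0, +oo). *)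
Definition lebesgue_Rpos :=
  mrestr (@completed_lebesgue_measure R) Lebesgue_measurable_Rpos.

HB.instance Definition _ := Measure.on lebesgue_Rpos.

End lebesgue_Rpos.
Arguments lebesgue_Rpos R : clear implicits.

Section subspaces.
Context (R : realType) (X : normedModType R).

Definition bounded_operator (P : X -> X) :=
  exists C : R, forall x, `|P x| <= C * `|x|.

Definition closed_subspace (M : set X) := submod_closed (mem M) /\ closed M.

Definition complemented (M : set X) :=
  closed_subspace M /\
  exists P : {linear X -> X},
    [/\ bounded_operator P, forall x, P (P x) = P x & range P = M].

(* M, with the topology induced by X, is linearly homeomorphic to Y; the
   values of S outside M are irrelevant. *)
Definition isomorphic_to (M : set X) (Y : normedModType R) :=
  exists (T : {linear Y -> X}) (S : X -> Y),
    [/\ continuous T, range T = M, cancel T S & {within M, continuous S}].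

End subspaces.

(* Main.v *)
Require Import Defs.
From HB Require Import structures.
From mathcomp Require Import all_boot all_order all_algebra.
From mathcomp Require Import all_classical all_reals all_analysis.
From mathcomp Require Import measurable_realfun ess_sup_inf.
From mathcomp Require Import ring lra.
Import Order.TTheory GRing.Theory Num.Theory.
Import numFieldNormedType.Exports.

(** Write X for the intersection of L_p and L_oo.

    If p = 2, the functions that are constant on each cell [n, n + 1) form a
    copy of l_2 in X: their L_2 norm is the l_2 norm of the sequence of values,
    and it dominates the supremum of the values. Taking the mean over each cell
    is a projection onto this copy; it has norm at most 1 by the inequality of
    Cauchy and Schwarz ([complemented_hilbert_exists]).

    Conversely, let U : X -> l_2 be a bounded left inverse of a bounded
    T : l_2 -> X, and let f_k be the image under T of the k-th unit vector. For
    a finite set s of n indices, put g_s = (sum over s of f_k ^ 2) ^ (1/2).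
    Everything rests on two estimates of g_s.

    - The lower one, [square_function_bound], gives n <= K sqrt(n) |g_s| in X.
      It comes from averaging over signs: the sum of the coordinates <U f_k, e_k>
      is n; the random sums of the f_k, cut off at height g_s, contribute at
      most K sqrt(n) |g_s| to it, and the remainder left by the cut-off has a
      square function of at most half of g_s, because the fourth moment of a
      random sum is at most 3 g_s ^ 4. So the remainder contributes at most half
      of what is to be bounded. The argument uses no duality and no
      representation of the functionals.

    - The upper one, [ae_sum_sq_bound]: since X contains the norm of L_oo, one
      has |sum a_k f_k| <= C |a| almost everywhere for each of the countably
      many integer vectors a, hence g_s <= C almost everywhere, with C
      independent of s.

    So for large n the L_p norm of g_s is at least sqrt(n) / K. The second
    estimate also yields f_k -> 0 almost everywhere, so the functions
    min(h, |f_k|) tend to 0 in L_p for every h in L_p, by dominated convergence.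
    Hence n of the f_k can be chosen to be nearly disjoint, in the sense that
    the sum and the maximum of their absolute values are close in L_p
    ([almost_disjoint]).

    If p > 2, near disjointness bounds the L_p norm of g_s by C n ^ (1/p) + 1,
    which is too small ([exponent_le2]). If p < 2, the lower estimate prevents
    the L_p norms of the f_k from tending to 0, so that n nearly disjoint f_k
    have a sum of L_p norm at least of the order of n ^ (1/p); but this sum is
    the image of a vector of norm sqrt(n) ([exponent_ge2]). *)

Set Implicit Arguments.
Unset Strict Implicit.
Unset Printing Implicit Defensive.
Local Open Scope classical_set_scope.
Local Open Scope ring_scope.

(** * Random signs *)

Section signs.
Context (R : realType) (I : finType).
Implicit Types (e : {ffun I -> bool}) (i j : I) (x : I -> R) (r : seq I).

Definition sgn e i : R := (-1) ^+ e i.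
Definition flip i e : {ffun I -> bool} := [ffun j => (j == i) (+) e j].
Definition nsigns : R := #|{ffun I -> bool}|%:R.

Lemma flipK i : involutive (flip i).
Proof. by move=> e; apply/ffunP => j; rewrite !ffunE addbA addbb. Qed.

Lemma sgn_flip i j e : sgn (flip i e) j = (-1) ^+ (j == i) * sgn e j.
Proof. by rewrite /sgn ffunE signr_addb. Qed.

Lemma sgnM e i : sgn e i * sgn e i = 1.
Proof. by rewrite /sgn -expr2 sqrr_sign. Qed.

Lemma normr_sgn e i : `|sgn e i| = 1.
Proof. exact: normr_sign. Qed.

Lemma nsigns_gt0 : 0 < nsigns.
Proof. by rewrite ltr0n; apply/card_gt0P; exists [ffun=> true]. Qed.

(** Pairing each choice of signs with the one that differs from it at [i]. *)
Lemma sum_odd0 i (F : {ffun I -> bool} -> R) :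
  (forall e, F (flip i e) = - F e) -> \sum_e F e = 0.
Proof.
move=> oddF; have : \sum_e F e = - \sum_e F e.
  rewrite [LHS](reindex_inj (inv_inj (flipK i))) -sumrN.
  by apply: eq_bigr => e _; rewrite oddF.
by move=> H; lra.
Qed.

Lemma sum_sgn2 i j : \sum_e sgn e i * sgn e j = nsigns * (i == j)%:R.
Proof.
have [->|ij] := eqVneq i j.
  under eq_bigr do rewrite sgnM.
  by rewrite sumr_const mulr1.
rewrite mulr0; apply: (@sum_odd0 i) => e.
rewrite !sgn_flip eqxx (eq_sym j) (negbTE ij) expr1 expr0 mul1r.
by rewrite mulN1r mulNr.
Qed.

(** The sign functions are orthonormal, so a coefficient is recovered from the
    random sum by averaging. *)
Lemma sgn_coord (z : I -> R) i :
  nsigns^-1 * \sum_e sgn e i * \sum_j sgn e j * z j = z i.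
Proof.
under eq_bigr do rewrite mulr_sumr.
rewrite exchange_big /= (bigD1 i)//= [X in _ + X]big1 ?addr0 => [|j ji].
  under eq_bigr do rewrite mulrA.
  by rewrite -mulr_suml sum_sgn2 eqxx mulr1 mulrA mulVf ?gt_eqF ?nsigns_gt0// mul1r.
under eq_bigr do rewrite mulrA.
by rewrite -mulr_suml sum_sgn2 eq_sym (negbTE ji) mulr0 mul0r.
Qed.

(** A Rademacher sum. *)
Definition rad x e r := \sum_(j <- r) sgn e j * x j.

Lemma rad_flip x i e r : i \notin r -> rad x (flip i e) r = rad x e r.
Proof.
move=> ir; apply: eq_big_seq => j jr; rewrite sgn_flip.
by have [ji|] := eqVneq j i; [rewrite -ji jr in ir|rewrite expr0 mul1r].
Qed.

(** Induction on [r]: expanding the square at a new index [i], the cross term is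
    odd in the sign at [i]. *)
Lemma rad_moment2 x r : uniq r ->
  \sum_e rad x e r ^+ 2 = nsigns * \sum_(j <- r) x j ^+ 2.
Proof.
elim: r => [_|i r IH /= /andP[ir ur]].
  under eq_bigr do rewrite /rad big_nil expr0n.
  by rewrite big_nil big1 ?mulr0.
under eq_bigr => e _.
  rewrite /rad big_cons -/(rad x e r).
  rewrite (_ : (_ + _) ^+ 2 = (rad x e r ^+ 2 + x i ^+ 2) +
     sgn e i * (2 * x i * rad x e r)); last first.
    by have := sgnM e i => h; ring: h.
  over.
rewrite big_split /= [X in _ + X](@sum_odd0 i) ?addr0; last first.
  by move=> e; rewrite rad_flip// sgn_flip eqxx mulN1r mulNr.
by rewrite big_split /= IH// sumr_const big_cons mulrDr addrC -[_ *+ _]mulr_natl.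
Qed.

(** In the expansion at a new index [i] only the even powers of its sign survive,
    and the mixed term 6 x ^ 2 S ^ 2 is evaluated by the second moment. *)
Lemma rad_moment4 x r : uniq r ->
  \sum_e rad x e r ^+ 4 <= 3 * nsigns * (\sum_(j <- r) x j ^+ 2) ^+ 2.
Proof.
elim: r => [_|i r IH /= /andP[ir ur]].
  under eq_bigr do rewrite /rad big_nil expr0n.
  by rewrite big_nil big1 // expr0n mulr0.
under eq_bigr => e _.
  rewrite /rad big_cons -/(rad x e r).
  rewrite (_ : (_ + _) ^+ 4 = (rad x e r ^+ 4 + (6 * x i ^+ 2) * rad x e r ^+ 2
     + x i ^+ 4) +
     sgn e i * (4 * x i * rad x e r ^+ 3 + 4 * x i ^+ 3 * rad x e r)); last first.
    by have := sgnM e i => h; ring: h.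
  over.
rewrite big_split /= [X in _ + X](@sum_odd0 i) ?addr0; last first.
  by move=> e; rewrite rad_flip// sgn_flip eqxx mulN1r mulNr.
rewrite big_split /= big_split /= -mulr_sumr rad_moment2// sumr_const big_cons.
rewrite -[_ *+ _]mulr_natl -/nsigns.
have := IH ur; have := nsigns_gt0; set N := nsigns; set s := \sum_(j <- r) _.
set M := \sum_e _ => N0 H.
have : 0 <= N * (x i ^+ 4) by rewrite mulr_ge0 ?(ltW N0)// exprn_even_ge0.
by move=> ?; lra.
Qed.

(** Bessel's inequality for the orthonormal system of the sign functions. *)
Lemma bessel (F : {ffun I -> bool} -> R) :
  \sum_i (nsigns^-1 * \sum_e sgn e i * F e) ^+ 2 <= nsigns^-1 * \sum_e F e ^+ 2.
Proof.
set c := fun i => nsigns^-1 * \sum_e sgn e i * F e.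
have N0 := nsigns_gt0.
have cE i : \sum_e sgn e i * F e = nsigns * c i.
  by rewrite /c mulrA mulfV ?mul1r// gt_eqF.
have : 0 <= \sum_e (F e - rad c e (index_enum I)) ^+ 2.
  by apply: sumr_ge0 => e _; exact: sqr_ge0.
under eq_bigr => e _ do rewrite sqrrB.
rewrite big_split /= rad_moment2 ?index_enum_uniq// sumrB sumrMnl.
have -> : \sum_e F e * rad c e (index_enum I) = nsigns * \sum_i c i ^+ 2.
  under eq_bigr do rewrite /rad mulr_sumr.
  rewrite exchange_big /= mulr_sumr; apply: eq_bigr => i _.
  rewrite expr2 mulrA -cE mulr_suml; apply: eq_bigr => e _.
  by ring.
rewrite -/(c _) => H; rewrite -(ler_pM2l N0) mulrA mulfV ?gt_eqF// mul1r.
move: H; set A := \sum_e _; set B := nsigns * _ => H.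
by rewrite mulr2n in H; lra.
Qed.

End signs.

(** * The square function of a complemented Hilbertian sequence *)

Section square_function_bound.
Context (R : realType) (I : finType) (T : Type).

Definition clamp (c x : R) := Num.max (- c) (Num.min c x).

Lemma normr_clamp c x : 0 <= c -> `|clamp c x| <= c.
Proof.
move=> c0; rewrite ler_norml /clamp le_max lexx /= ge_max ge_min lexx /=; lra.
Qed.

(** For |x| >= c this is 4 c (|x| - c) <= x ^ 2. It trades the part of [x] above
    [c] for a fourth power, which the fourth moment controls. *)
Lemma clamp_tail (c x : R) : 0 <= c -> 16 * c ^+ 2 * (x - clamp c x) ^+ 2 <= x ^+ 4.
Proof.
move=> c0; rewrite /clamp.
have H a : 16 * c ^+ 2 * (a - c) ^+ 2 <= a ^+ 4 \/ a < c.
  have [ca|] := leP c a; [left|by right].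
  have -> : 16 * c ^+ 2 * (a - c) ^+ 2 = (4 * c * (a - c)) ^+ 2 by ring.
  rewrite -[4%N]/(2 * 2)%N exprM lerXn2r ?nnegrE ?sqr_ge0 ?mulr_ge0 ?subr_ge0//.
  by rewrite -subr_ge0 (_ : _ - _ = (a - 2 * c) ^+ 2) ?sqr_ge0//; ring.
have even4 (a : R) : (- a) ^+ 4 = a ^+ 4 by ring.
have [cx|xc] := leP c x.
  by rewrite max_r; [case: (H x) => //; lra|lra].
have [xNc|Ncx] := leP x (- c).
  rewrite -even4 (_ : (x - - c) ^+ 2 = (- x - c) ^+ 2); last by ring.
  by case: (H (- x)) => //; lra.
by rewrite subrr expr0n mulr0 exprn_even_ge0.
Qed.

(** [V] is a vector space of functions, and the [y i] are linear functionals on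
    it which are jointly bounded by [D] on the order interval of [g]; for the
    coordinates of an operator into l_2 this follows from the inequality of
    Cauchy and Schwarz. *)
Variables (V : set (T -> R)) (y : I -> (T -> R) -> R) (g : T -> R) (D : R).
Hypothesis V0 : V 0.
Hypothesis Vlin : forall (a : R) f h, V f -> V h -> V (a *: f + h).
Hypothesis Vclamp : forall f, V f -> V (fun t => clamp (g t) (f t)).
Hypothesis ylin : forall i (a : R) f h, V f -> V h ->
  y i (a *: f + h) = a * y i f + y i h.
Hypothesis ybd : forall e f, V f -> (forall t, `|f t| <= g t) ->
  `|\sum_i sgn R e i * y i f| <= D.
Hypothesis g0 : forall t, 0 <= g t.

Lemma closed_lincomb (J : Type) (r : seq J) (c : J -> R) (f : J -> T -> R) :
  (forall j, V (f j)) -> V (\sum_(j <- r) c j *: f j).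
Proof. by move=> Vf; elim: r => [|j r IH]; rewrite ?big_nil// big_cons; exact: Vlin. Qed.

Lemma functional_lincomb (J : Type) (r : seq J) (c : J -> R) (f : J -> T -> R) i :
  (forall j, V (f j)) ->
  y i (\sum_(j <- r) c j *: f j) = \sum_(j <- r) c j * y i (f j).
Proof.
move=> Vf; elim: r => [|j r IH]; last first.
  by rewrite !big_cons ylin// ?IH//; exact: closed_lincomb.
rewrite !big_nil; have := ylin i 1 V0 V0; rewrite scale1r addr0 mul1r => h.
by lra.
Qed.

Definition admissible (phi : I -> T -> R) :=
  (forall i, V (phi i)) /\ forall t, \sum_i phi i t ^+ 2 <= g t ^+ 2.

Let N := nsigns R I.
Let N0 : 0 < N. Proof. exact: nsigns_gt0. Qed.

(** Only the finiteness of this crude bound matters: it allows taking a supremum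
    over all admissible families. *)
Lemma admissible_bound phi : admissible phi -> \sum_i y i (phi i) <= #|I|%:R * D.
Proof.
move=> [Vphi phig]; rewrite -sum1_card natr_sum mulr_suml; apply: ler_sum => i _.
rewrite mul1r -(sgn_coord (fun j => y j (phi i)) i) ler_pdivrMl//.
apply: (@le_trans _ _ (\sum_(e : {ffun I -> bool}) D)); last first.
  by rewrite sumr_const -[leLHS]mulr_natl.
apply: ler_sum => e _; apply: le_trans (ler_norm _) _.
rewrite normrM normr_sgn mul1r; apply: ybd => // t.
rewrite -(@ler_pXn2r _ 2)// ?nnegrE// real_normK ?num_real//.
apply: le_trans (phig t); rewrite (bigD1 i)//= lerDl.
by apply: sumr_ge0 => j _; exact: sqr_ge0.
Qed.

(** The random sums [S e] of the [phi i] split into the clamped part [tau e],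
    bounded by [g], and the remainder [rho e]. The first contributes at most [D];
    by the fourth moment, the mean square of the second is at most 3/16 g ^ 2, so
    that by Bessel's inequality twice its sign coefficients, [psi], are
    admissible again. *)
Lemma admissible_improve phi : admissible phi ->
  exists2 psi, admissible psi &
    \sum_i y i (phi i) <= D + 2^-1 * \sum_i y i (psi i).
Proof.
move=> [Vphi phig].
pose S e : T -> R := \sum_j sgn R e j *: phi j.
pose tau e : T -> R := fun t => clamp (g t) (S e t).
pose rho e : T -> R := (-1) *: tau e + S e.
have VS e : V (S e) by exact: closed_lincomb.
have Vtau e : V (tau e) by exact: Vclamp.
have Vrho e : V (rho e) by exact: Vlin.
pose psi i : T -> R := \sum_e (2 * N^-1 * sgn R e i) *: rho e.
have SE e t : S e t = rad (fun j => phi j t) e (index_enum I).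
  by rewrite /S fct_sumE.
have rhoE e t : rho e t = S e t - tau e t.
  by rewrite /rho fctE /= scaleN1r addrC.
have psiE i t : psi i t = 2 * (N^-1 * \sum_e sgn R e i * rho e t).
  rewrite /psi fct_sumE !mulr_sumr; apply: eq_bigr => e _.
  by rewrite -[LHS]/(2 * N^-1 * sgn R e i * rho e t) -!mulrA.
exists psi.
  split=> [i|t]; first exact: closed_lincomb.
  under eq_bigr => i _ do rewrite psiE exprMn.
  rewrite -mulr_sumr.
  have := bessel (fun e => rho e t); rewrite -/N => B.
  have [gt0|] := eqVneq (g t) 0.
    have S0 e : S e t = 0.
      rewrite SE /rad big1// => i _.
      suff -> : phi i t = 0 by rewrite mulr0.
      apply/eqP; rewrite -sqrf_eq0; apply/eqP; apply: le_anti.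
      rewrite sqr_ge0 andbT; have := phig t; rewrite gt0 expr0n/=.
      apply: le_trans; rewrite (bigD1 i)//= lerDl.
      by apply: sumr_ge0 => j _; exact: sqr_ge0.
    move: B; rewrite [X in _ <= _ * X]big1 ?mulr0 => [B|e _]; last first.
      by rewrite rhoE /tau S0 gt0 /clamp minxx oppr0 maxxx subrr expr0n.
    by rewrite gt0 expr0n /= mulr_ge0_le0 ?sqr_ge0.
  move=> gn0; have gp : 0 < g t by rewrite lt_neqAle eq_sym gn0 g0.
  have M4 : \sum_e S e t ^+ 4 <= 3 * N * (g t ^+ 2) ^+ 2.
    under eq_bigr do rewrite SE.
    apply: le_trans (rad_moment4 _ (index_enum_uniq _)) _.
    rewrite ler_pM2l ?mulr_gt0// lerXn2r ?nnegrE ?sqr_ge0//.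
    by apply: sumr_ge0 => j _; exact: sqr_ge0.
  have M2 : 16 * g t ^+ 2 * \sum_e rho e t ^+ 2 <= 3 * N * (g t ^+ 2) ^+ 2.
    apply: le_trans M4; rewrite mulr_sumr; apply: ler_sum => e _.
    by rewrite rhoE; exact: clamp_tail.
  have gg : 0 < g t ^+ 2 by rewrite exprn_gt0.
  have {}M2 : \sum_e rho e t ^+ 2 <= N * (3 / 16 * g t ^+ 2).
    rewrite -(@ler_pM2l _ (16 * g t ^+ 2)) ?mulr_gt0//; apply: le_trans M2 _.
    by lra.
  rewrite -ler_pdivrMl// in M2.
  by move: B M2; set A := \sum_i _; set b := N^-1 * _ => B M2; lra.
have -> : \sum_i y i (phi i) = N^-1 * \sum_e \sum_i sgn R e i * y i (S e).
  rewrite exchange_big mulr_sumr; apply: eq_bigr => i _ /=.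
  under eq_bigr => e _ do rewrite functional_lincomb//.
  by rewrite -[LHS](sgn_coord (fun j => y i (phi j))).
have yS i e : y i (S e) = y i (tau e) + y i (rho e).
  rewrite addrC -[y i (rho e)]mul1r -ylin//; congr y.
  by apply/funext => t; rewrite scale1r addrfctE rhoE subrK.
have -> : 2^-1 * \sum_i y i (psi i) = N^-1 * \sum_e \sum_i sgn R e i * y i (rho e).
  rewrite exchange_big !mulr_sumr; apply: eq_bigr => i _ /=.
  rewrite functional_lincomb// !mulr_sumr; apply: eq_bigr => e _.
  by field; rewrite gt_eqF.
under eq_bigr do under eq_bigr do rewrite yS mulrDr.
under eq_bigr do rewrite big_split.
rewrite big_split /= mulrDr lerD2r ler_pdivrMl//.
apply: (@le_trans _ _ (\sum_(e : {ffun I -> bool}) D)); last first.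
  by rewrite sumr_const -[leLHS]mulr_natl.
apply: ler_sum => e _; apply: le_trans (ler_norm _) _; apply: ybd => // t.
exact: normr_clamp.
Qed.

(** By [admissible_improve], the supremum K of the left-hand side over admissible
    families satisfies K <= D + K / 2. *)
Lemma square_function_bound phi : admissible phi -> \sum_i y i (phi i) <= 2 * D.
Proof.
move=> aphi.
pose A := [set s | exists2 psi, admissible psi & s = \sum_i y i (psi i)].
have supA : has_sup A.
  split; first by exists (\sum_i y i (phi i)), phi.
  by exists (#|I|%:R * D) => _ [psi apsi ->]; exact: admissible_bound.
have H : sup A <= D + 2^-1 * sup A.
  apply: ge_sup; first by case: supA.
  move=> _ [f af ->]; have [h ah /le_trans] := admissible_improve af; apply.
  rewrite lerD2l ler_pM2l//; apply: ub_le_sup; first by case: supA.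
  by exists h.
apply: (@le_trans _ _ (sup A)); last by lra.
by apply: ub_le_sup; [case: supA|exists phi].
Qed.

End square_function_bound.

(** * Maxima and sums of finitely many reals *)

Section peaks.
Context (R : realType).
Implicit Types (a : nat -> R) (s : seq nat).

(** For functions, [abs_sum] and [peak] agree where the supports are disjoint; the
    size of their difference measures how far a family is from being disjoint. *)
Definition peak a s : R := \big[Num.max/0]_(k <- s) `|a k|.
Definition abs_sum a s : R := \sum_(k <- s) `|a k|.

Lemma peak_ge0 a s : 0 <= peak a s.
Proof. by rewrite /peak; elim/big_rec: _ => // k x _ x0; rewrite le_max x0 orbT. Qed.

Lemma abs_sum_ge0 a s : 0 <= abs_sum a s.
Proof. exact: sumr_ge0. Qed.

Lemma peak_cons a k s : peak a (k :: s) = Num.max `|a k| (peak a s).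
Proof. by rewrite /peak big_cons. Qed.

Lemma abs_sum_cons a k s : abs_sum a (k :: s) = `|a k| + abs_sum a s.
Proof. by rewrite /abs_sum big_cons. Qed.

(** The defect of disjointness grows by the overlap of the new term with the
    previous maximum. *)
Lemma abs_sum_sub_peak_cons a k s :
  abs_sum a (k :: s) - peak a (k :: s) =
  abs_sum a s - peak a s + Num.min (peak a s) `|a k|.
Proof. by rewrite abs_sum_cons peak_cons; have [_|_] := leP `|a k| (peak a s); lra. Qed.

Lemma peak_le_abs_sum a s : peak a s <= abs_sum a s.
Proof.
elim: s => [|k s IH]; first by rewrite /peak /abs_sum !big_nil.
rewrite peak_cons abs_sum_cons ge_max lerDl abs_sum_ge0 /=.
by apply: le_trans IH _; rewrite lerDr.
Qed.

Lemma norm_sum_le_abs_sum a s : `|\sum_(k <- s) a k| <= abs_sum a s.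
Proof. exact: ler_norm_sum. Qed.

(** The largest term can be cancelled only by the other ones, which add up to
    [abs_sum a s - peak a s]. *)
Lemma peak_le_norm_sum a s :
  peak a s <= `|\sum_(k <- s) a k| + (abs_sum a s - peak a s).
Proof.
suff : 2 * peak a s <= `|\sum_(k <- s) a k| + abs_sum a s by lra.
elim: s => [|k s IH]; first by rewrite /peak /abs_sum !big_nil normr0; lra.
rewrite peak_cons abs_sum_cons big_cons.
have := norm_sum_le_abs_sum a s; set y := \sum_(_ <- _) _ in IH *.
have h1 : `|a k| <= `|a k + y| + `|y|.
  by have := ler_normB (a k + y) y; rewrite addrK.
have h2 : `|y| <= `|a k + y| + `|a k|.
  by have := ler_normB (a k + y) (a k); rewrite addrAC subrr add0r.
by have [_|_] := leP `|a k| (peak a s); lra.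
Qed.

(** The maximum and the minimum of two numbers are these numbers, in some order. *)
Lemma peak_powR_cons (p : R) a k s :
  peak a (k :: s) `^ p + (Num.min (peak a s) `|a k|) `^ p =
  peak a s `^ p + `|a k| `^ p.
Proof. by rewrite peak_cons; have [_|_] := leP `|a k| (peak a s); rewrite 1?addrC. Qed.

Lemma peak_powR_le (p : R) a s : p != 0 ->
  peak a s `^ p <= \sum_(k <- s) `|a k| `^ p.
Proof.
move=> p0; elim: s => [|k s IH]; first by rewrite /peak !big_nil powR0.
rewrite big_cons -(lerD2r ((Num.min (peak a s) `|a k|) `^ p)) peak_powR_cons.
have := powR_ge0 (Num.min (peak a s) `|a k|) p; lra.
Qed.

Lemma sqrt_sum_sq_le_abs_sum a s : Num.sqrt (\sum_(k <- s) a k ^+ 2) <= abs_sum a s.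
Proof.
rewrite -(@ler_pXn2r _ 2)// ?nnegrE ?sqrtr_ge0 ?abs_sum_ge0// sqr_sqrtr; last first.
  by apply: sumr_ge0 => k _; exact: sqr_ge0.
elim: s => [|k s IH]; first by rewrite /abs_sum !big_nil expr0n.
rewrite big_cons abs_sum_cons; have := abs_sum_ge0 a s.
have := normr_ge0 (a k); rewrite -[a k ^+ 2]real_normK ?num_real//.
by nra.
Qed.

End peaks.

(** * Lebesgue norms and integrals of powers *)

Section Lnorm_lemmas.
Context d (T : measurableType d) (R : realType) (mu : {measure set T -> \bar R}).
Implicit Types f g : T -> R.

Lemma le_Lnorm_ae (q : \bar R) f g : (1 <= q)%E ->
  measurable_fun setT f -> measurable_fun setT g ->
  {ae mu, forall t, `|f t| <= `|g t|} ->
  ('N[mu]_q[EFin \o f] <= 'N[mu]_q[EFin \o g])%E.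
Proof.
move=> q1 mf mg fg; rewrite unlock /Lnorm; case: q q1 => [r r1|_|//].
  have r0 : 0 <= r by rewrite lee_fin in r1; exact: le_trans r1.
  apply: gt0_ler_poweR; rewrite ?invr_ge0 ?in_itv/= ?andbT ?leey ?integral_ge0//.
  apply: ae_ge0_le_integral => //; last first.
  - apply: filterS fg => t /= h _; rewrite lee_fin.
    by apply: ge0_ler_powR; rewrite ?nnegrE.
  - apply/measurable_EFinP; apply: (measurableT_comp (measurable_powR r)).
    exact: measurableT_comp.
  - apply/measurable_EFinP; apply: (measurableT_comp (measurable_powR r)).
    exact: measurableT_comp.
case: ifP => // _; apply: le_ess_sup.
by apply: filterS fg => t /= h; rewrite lee_fin.
Qed.

Lemma Lnorm_poweR (p : R) f : 0 < p ->
  ('N[mu]_p%:E[EFin \o f] `^ p = \int[mu]_t (`|f t| `^ p)%:E)%E.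
Proof.
move=> p0; rewrite poweR_Lnorm ?gt_eqF//.
Qed.

Lemma Lnorm_le_integral (p e : R) f : 0 < p -> 0 <= e ->
  (\int[mu]_t (`|f t| `^ p)%:E <= (e `^ p)%:E)%E ->
  ('N[mu]_p%:E[EFin \o f] <= e%:E)%E.
Proof.
move=> p0 e0; rewrite -Lnorm_poweR// -poweR_EFin; set x := 'N[mu]_p%:E[_]%E => h.
have -> : x = ((x `^ p) `^ p^-1)%E.
  by rewrite -poweRrM mulfV ?gt_eqF// poweRe1// Lnorm_ge0.
have -> : e%:E = ((e%:E `^ p) `^ p^-1)%E.
  by rewrite -poweRrM mulfV ?gt_eqF// poweRe1.
apply: gt0_ler_poweR; rewrite ?invr_ge0 ?(ltW p0)//;
  rewrite ?in_itv/= ?leey ?andbT ?lee_fin ?powR_ge0//.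
by rewrite poweR_ge0.
Qed.

Lemma measurable_powR_EFin (p : R) f : measurable_fun setT f ->
  measurable_fun setT (fun t => (f t `^ p)%:E).
Proof.
move=> mf; apply/measurable_EFinP.
exact: (measurableT_comp (measurable_powR p)).
Qed.

Lemma integral_powRD (p : R) (f1 f2 g1 g2 : T -> R) :
  measurable_fun setT f1 -> measurable_fun setT f2 ->
  measurable_fun setT g1 -> measurable_fun setT g2 ->
  (forall t, f1 t `^ p + f2 t `^ p = g1 t `^ p + g2 t `^ p) ->
  (\int[mu]_t (f1 t `^ p)%:E + \int[mu]_t (f2 t `^ p)%:E =
   \int[mu]_t (g1 t `^ p)%:E + \int[mu]_t (g2 t `^ p)%:E)%E.
Proof.
move=> mf1 mf2 mg1 mg2 E.
have pw0 (h : T -> R) t : setT t -> (0 <= (h t `^ p)%:E)%E.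
  by move=> _; rewrite lee_fin powR_ge0.
have mpw := @measurable_powR_EFin p.
rewrite -(ge0_integralD mu measurableT (pw0 _) (mpw _ mf1) (pw0 _) (mpw _ mf2)).
rewrite -(ge0_integralD mu measurableT (pw0 _) (mpw _ mg1) (pw0 _) (mpw _ mg2)).
by apply: eq_integral => t _; rewrite -!EFinD E.
Qed.

End Lnorm_lemmas.

(** * From an upper Hilbert estimate to a pointwise square sum *)

Section square_sum_bound.
Context d (T : measurableType d) (R : realType) (mu : {measure set T -> \bar R}).

(** The case z = x is the claim; the vectors floor(m x), for m large, replace it.
    Integer vectors are used because they are countably many. *)
Lemma sum_sq_bound (C : R) n (x : 'I_n -> R) : 0 <= C ->
  (forall z : {ffun 'I_n -> int},
    `|\sum_i (z i)%:~R * x i| <= C * Num.sqrt (\sum_i (z i)%:~R ^+ 2)) ->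
  \sum_i x i ^+ 2 <= C ^+ 2.
Proof.
move=> C0 H; rewrite leNgt; apply/negP => Cs.
set s := \sum_i x i ^+ 2 in Cs; pose L := \sum_i `|x i|.
have s0 : 0 <= s by apply: sumr_ge0 => i _; exact: sqr_ge0.
have L0 : 0 <= L by exact: sumr_ge0.
(* [L] bounds the error made in replacing [m x] by its integer part. *)
have key m : 1 <= m%:R :> R ->
    (m%:R * s - L) ^+ 2 <= C ^+ 2 * (m%:R ^+ 2 * s + 2 * m%:R * L + n%:R)
      \/ m%:R * s < L.
  move=> m1; have [Lm|] := leP L (m%:R * s); [left|by right].
  pose z : {ffun 'I_n -> int} := [ffun i => Num.floor (m%:R * x i)].
  have zb i : `|m%:R * x i - (z i)%:~R| <= 1.
    rewrite ffunE; have /andP[h1 h2] := floor_itv (m%:R * x i).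
    by rewrite intrD in h2; rewrite ger0_norm ?subr_ge0//; lra.
  have h1 : m%:R * s - L <= \sum_i (z i)%:~R * x i.
    rewrite /s /L mulr_sumr -sumrB; apply: ler_sum => i _.
    have : (m%:R * x i - (z i)%:~R) * x i <= `|x i|.
      apply: le_trans (ler_norm _) _; rewrite normrM -[leRHS]mul1r.
      by rewrite ler_wpM2r.
    by rewrite mulrBl -mulrA -expr2; lra.
  have h2 : \sum_i (z i)%:~R ^+ 2 <= m%:R ^+ 2 * s + 2 * m%:R * L + n%:R :> R.
    have -> : m%:R ^+ 2 * s + 2 * m%:R * L + n%:R =
        \sum_i (m%:R ^+ 2 * x i ^+ 2 + 2 * m%:R * `|x i| + 1).
      by rewrite !big_split -!mulr_sumr sumr_const card_ord.
    apply: ler_sum => i _; have := zb i; set w := _%:~R; rewrite ler_norml => /andP[a b].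
    have := normr_ge0 (x i); have : `|w| <= m%:R * `|x i| + 1.
      rewrite -[X in X * `|x i|]ger0_norm ?(le_trans _ m1)// -normrM.
      rewrite -lerBlDl; apply: le_trans (lerB_dist _ _) _.
      by rewrite distrC ler_norml a b.
    rewrite -(real_normK (num_real w)) -(real_normK (num_real (x i))).
    have := normr_ge0 w; set W := `|w|; set X := `|x i| => W0 WX X0.
    have : W ^+ 2 <= (m%:R * X + 1) ^+ 2.
      by rewrite lerXn2r// nnegrE// addr_ge0// mulr_ge0.
    by lra.
  have := le_trans h1 (le_trans (ler_norm _) (H z)) => h3.
  apply: (@le_trans _ _ ((C * Num.sqrt (\sum_i (z i)%:~R ^+ 2)) ^+ 2)).
    by rewrite lerXn2r// nnegrE ?subr_ge0// mulr_ge0// sqrtr_ge0.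
  rewrite exprMn sqr_sqrtr; last by apply: sumr_ge0 => i _; exact: sqr_ge0.
  by rewrite ler_wpM2l ?sqr_ge0.
have sp : 0 < s by exact: le_lt_trans (sqr_ge0 C) Cs.
pose q := 2 * s * L + 2 * C ^+ 2 * L + C ^+ 2 * n%:R.
have q0 : 0 <= q by rewrite /q !(addr_ge0, mulr_ge0, sqr_ge0).
pose e := s * (s - C ^+ 2).
have e0 : 0 < e by rewrite mulr_gt0// subr_gt0.
pose m := (Num.truncn (q / e + L / s)).+2.
have mb : q / e + L / s < m%:R - 1.
  rewrite /m -addn1 natrD addrK; exact: truncnS_gt.
have qe0 : 0 <= q / e by rewrite divr_ge0 ?(ltW e0).
have Ls0 : 0 <= L / s by rewrite divr_ge0.
have m1 : 1 <= m%:R :> R by lra.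
have [K|] := key m m1; last first.
  by rewrite mulrC -ltr_pdivlMl// mulrC; lra.
have : m%:R ^+ 2 * e <= m%:R * q.
  apply: (@le_trans _ _ (2 * m%:R * s * L + 2 * m%:R * C ^+ 2 * L + C ^+ 2 * n%:R)).
    by have := sqr_ge0 L; rewrite /e; lra.
  rewrite /q; have : C ^+ 2 * n%:R <= m%:R * (C ^+ 2 * n%:R).
    by rewrite -[leLHS]mul1r ler_wpM2r// mulr_ge0// sqr_ge0.
  by clear; move: (m%:R : R) (n%:R : R) => M k; lra.
rewrite expr2 -mulrA ler_pM2l; last by lra.
by rewrite -ler_pdivlMr//; lra.
Qed.

Lemma ae_sum_sq_bound (C : R) (f : nat -> T -> R) : 0 <= C ->
  (forall n (z : {ffun 'I_n -> int}), {ae mu, forall t,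
     `|\sum_i (z i)%:~R * f i t| <= C * Num.sqrt (\sum_i (z i)%:~R ^+ 2)}) ->
  {ae mu, forall t n, \sum_(i < n) f i t ^+ 2 <= C ^+ 2}.
Proof.
move=> C0 H; apply/ae_foralln => n.
have : {ae mu, forall t (k : nat),
   if (unpickle k : option {ffun 'I_n -> int}) is Some z then
   `|\sum_i (z i)%:~R * f i t| <= C * Num.sqrt (\sum_(i < n) (z i)%:~R ^+ 2)
   else true}.
  by apply/ae_foralln => k; case: unpickle => [z|]; [exact: H|exact: nearW].
apply: filterS => t h; apply: sum_sq_bound => // z.
by have := h (pickle z); rewrite pickleK.
Qed.

End square_sum_bound.

(** * Almost disjoint subfamilies of a null sequence *)

Section almost_disjoint.
Context d (T : measurableType d) (R : realType) (mu : {measure set T -> \bar R}).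
Variables (p : R) (p1 : 1 <= p) (f : nat -> T -> R).
Hypothesis mf : forall k, measurable_fun setT (f k).

Lemma measurable_peak s : measurable_fun setT (fun t => peak (f^~ t) s).
Proof.
elim: s => [|k s IH].
  by rewrite (_ : (fun _ => _) = cst 0)//; apply/funext => t; rewrite /peak big_nil.
rewrite (_ : (fun _ => _) = (fun t => Num.max `|f k t| (peak (f^~ t) s))); last first.
  by apply/funext => t; rewrite peak_cons.
by apply: measurable_maxr => //; exact: measurableT_comp.
Qed.

Lemma measurable_abs_sum s : measurable_fun setT (fun t => abs_sum (f^~ t) s).
Proof. by apply: measurable_sum => k; exact: measurableT_comp. Qed.

Hypothesis finf : forall k, (\int[mu]_t (`|f k t| `^ p)%:E < +oo)%E.
Hypothesis f0 : {ae mu, forall t, f ^~ t @ \oo --> 0}.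

(** The convergence is dominated by [G `^ p]; pointwise, min(G, |f_k|) ^ p is at
    most |f_k| G ^ (p - 1). *)
Lemma overlap_cvg0 (G : T -> R) : measurable_fun setT G ->
  (forall t, 0 <= G t) -> (\int[mu]_t (G t `^ p)%:E < +oo)%E ->
  (\int[mu]_t (Num.min (G t) `|f k t| `^ p)%:E @[k --> \oo] --> 0)%E.
Proof.
move=> mG G0 Goo.
have p0 : 0 < p by exact: lt_le_trans p1.
have mov k : measurable_fun setT (fun t => (Num.min (G t) `|f k t| `^ p)%:E).
  apply: measurable_powR_EFin; apply: measurable_minr => //.
  exact: measurableT_comp.
have ov0 : {ae mu, forall t, setT t ->
    (Num.min (G t) `|f k t| `^ p)%:E @[k --> \oo] --> 0%E}.
  apply: filterS f0 => t ft _; apply: cvg_EFin; first exact: nearW.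
  apply: (@squeeze_cvgr _ _ _ _ (cst 0) (fun k => `|f k t| * G t `^ (p - 1))).
  + apply: nearW => k; rewrite powR_ge0 /=.
    have m0 : 0 <= Num.min (G t) `|f k t| by rewrite le_min G0 normr_ge0.
    rewrite -mulr_powRB1// ler_pM ?powR_ge0//; first by rewrite ge_min lexx orbT.
    by rewrite ge0_ler_powR ?nnegrE ?subr_ge0// ge_min lexx.
  + exact: cvg_cst.
  + rewrite -[X in _ --> X](mul0r (G t `^ (p - 1))); apply: cvgMr_tmp.
    by rewrite -[X in _ --> X](@normr0 R R); exact: cvg_norm.
have iG : mu.-integrable setT (fun t => (G t `^ p)%:E).
  apply/integrableP; split; first exact: measurable_powR_EFin.
  by under eq_integral => t _ do rewrite gee0_abs ?lee_fin ?powR_ge0//.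
have ovG : {ae mu, forall t k, setT t ->
    (`|(Num.min (G t) `|f k t| `^ p)%:E| <= (G t `^ p)%:E)%E}.
  apply: nearW => t k _; rewrite gee0_abs ?lee_fin ?powR_ge0//.
  by rewrite ge0_ler_powR ?nnegrE ?ge_min ?lexx ?le_min ?G0 ?normr_ge0// ltW.
have [_ _] := dominated_convergence measurableT mov (measurable_cst _) ov0 iG ovG.
by rewrite integral0.
Qed.

(** The indices are chosen one after the other, each so large that the overlap
    with the maximum of the previous functions is small, by [overlap_cvg0]. *)
Lemma almost_disjoint (P : nat -> Prop) (n : nat) (e : R) : 0 < e ->
  (forall k0, exists2 k, (k0 <= k)%N & P k) ->
  exists s, [/\ uniq s, size s = n, forall k, k \in s -> P k,
    ('N[mu]_p%:E[EFin \o (fun t => (abs_sum (f^~ t) s - peak (f^~ t) s)%R)] <= e%:E)%E &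
    (\sum_(k <- s) \int[mu]_t (`|f k t| `^ p)%:E <=
     \int[mu]_t (peak (f^~ t) s `^ p)%:E + e%:E)%E].
Proof.
move=> e0 infP.
have p0 : 0 < p by exact: lt_le_trans p1.
suff : exists s, [/\ uniq s, size s = n, forall k, k \in s -> P k,
    ('N[mu]_p%:E[EFin \o (fun t => (abs_sum (f^~ t) s - peak (f^~ t) s)%R)] <= e%:E)%E &
    ((\sum_(k <- s) \int[mu]_t (`|f k t| `^ p)%:E <=
     \int[mu]_t (peak (f^~ t) s `^ p)%:E + e%:E)%E /\
    (\int[mu]_t (peak (f^~ t) s `^ p)%:E < +oo)%E)].
  by case=> s [? ? ? ? [? ?]]; exists s.
elim: n e e0 => [|n IH] e e0.
  exists [::]; split => //.
  - have -> : EFin \o (fun t => abs_sum (f^~ t) [::] - peak (f^~ t) [::]) = cst 0%E.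
      by apply/funext => t; rewrite /= /peak /abs_sum !big_nil subrr.
    by rewrite Lnorm0 ?lee_fin ?ltW// gt_eqF.
  - split.
      rewrite big_nil adde_ge0 ?lee_fin ?(ltW e0)//.
      by apply: integral_ge0 => t _; rewrite lee_fin powR_ge0.
    under eq_integral => t _ do rewrite /peak big_nil powR0 ?gt_eqF//.
    by rewrite integral0.
have e20 : 0 < e / 2 by rewrite divr_gt0.
have [s [us sn sP sN [sI soo]]] := IH _ e20.
(* The integral of the p-th power of the overlap enters the last estimate, its
   p-th root the norm estimate. *)
pose e' := Num.min (e / 2) ((e / 2) `^ p).
have e'0 : 0 < e' by rewrite lt_min e20 powR_gt0.
have := overlap_cvg0 (measurable_peak s) (fun t => peak_ge0 _ s) soo.
move=> /fine_cvgP[finI] /cvgrPdist_lt /(_ _ e'0) nearI.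
have [K _ KH] : \forall k \near \oo, (\max_(i <- s) i < k)%N /\
    (\int[mu]_t (Num.min (peak (f^~ t) s) `|f k t| `^ p)%:E <= e'%:E)%E.
  near=> k; split; first by near: k; exact: nbhs_infty_gt.
  rewrite -[leLHS]fineK; last by near: k.
  rewrite lee_fin; apply: le_trans (ler_norm _) _; rewrite -normrN -[X in `|X|]add0r.
  by apply: ltW; near: k.
have [k Kk Pk] := infP K; have [sk Ik] := KH k Kk.
have ks : k \notin s.
  by apply/negP => ks; have := @leq_bigmax_seq _ s xpredT id k ks isT; rewrite leqNgt sk.
pose ov t := Num.min (peak (f^~ t) s) `|f k t|.
have ov0 t : 0 <= ov t by rewrite le_min peak_ge0 normr_ge0.
have mov : measurable_fun setT ov.
  by apply: measurable_minr; [exact: measurable_peak|exact: measurableT_comp].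
have E : (\int[mu]_t (peak (f^~ t) (k :: s) `^ p)%:E + \int[mu]_t (ov t `^ p)%:E =
    \int[mu]_t (peak (f^~ t) s `^ p)%:E + \int[mu]_t (`|f k t| `^ p)%:E)%E.
  apply: integral_powRD => [||||t].
  - exact: measurable_peak.
  - exact: mov.
  - exact: measurable_peak.
  - exact: measurableT_comp.
  - exact: peak_powR_cons.
have J0 (h : T -> R) : (0 <= \int[mu]_t (h t `^ p)%:E)%E.
  by apply: integral_ge0 => t _; rewrite lee_fin powR_ge0.
exists (k :: s); split.
- by rewrite /= ks.
- by rewrite /= sn.
- by move=> i; rewrite inE => /predU1P[->//|/sP].
- have -> : (fun t => abs_sum (f^~ t) (k :: s) - peak (f^~ t) (k :: s)) =
      (fun t => abs_sum (f^~ t) s - peak (f^~ t) s) \+ ov.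
    by apply/funext => t; rewrite abs_sum_sub_peak_cons.
  have mD : measurable_fun setT (fun t => abs_sum (f^~ t) s - peak (f^~ t) s).
    by apply: measurable_funB; [exact: measurable_abs_sum|exact: measurable_peak].
  have p1E : (1 <= p%:E)%E by rewrite lee_fin.
  apply: le_trans (eminkowski mu mD mov p1E) _.
  have -> : (e%:E = (e / 2)%:E + (e / 2)%:E)%E by rewrite -EFinD -splitr.
  apply: leeD sN _; apply: Lnorm_le_integral; [by []|exact: ltW|].
  have -> : (\int[mu]_t (`|ov t| `^ p)%:E = \int[mu]_t (ov t `^ p)%:E)%E.
    by apply: eq_integral => t _; rewrite ger0_norm.
  by apply: le_trans Ik _; rewrite lee_fin ge_min lexx orbT.
- rewrite big_cons;
  have {}Ik : (\int[mu]_t (ov t `^ p)%:E <= (e / 2)%:E)%E.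
    by apply: le_trans Ik _; rewrite lee_fin ge_min lexx.
  have -> : (e%:E = (e / 2)%:E + (e / 2)%:E)%E by rewrite -EFinD -splitr.
  have absorb (a b c u x y : \bar R) : (0 <= b -> a + b = c + u -> b <= y ->
      x <= c + y -> c < +oo -> u < +oo -> u + x <= a + (y + y) /\ a < +oo)%E.
    move=> b0 abcu bY xcy coo uoo; split; last first.
      by apply: le_lt_trans (leeDl a b0) _; rewrite abcu lte_add_pinfty.
    apply: le_trans (leeD (lexx _) xcy) _.
    by rewrite addeA [X in (X + _)%E]addeC -abcu -addeA !leeD.
  exact: absorb (J0 ov) E Ik sI soo (finf k).
Unshelve. all: by end_near. Qed.

End almost_disjoint.

(** * The exponent is forced to be 2 *)

Section dichotomy.
Context d (T : measurableType d) (R : realType) (mu : {measure set T -> \bar R}).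
Variables (p : R) (p1 : 1 <= p) (f : nat -> T -> R) (B C : R).
Hypothesis mf : forall k, measurable_fun setT (f k).
Hypothesis f0 : {ae mu, forall t, f ^~ t @ \oo --> 0}.
Hypotheses (B0 : 0 < B) (C0 : 0 < C).
(** [upper] holds as the sum is the image of a vector of norm sqrt(n); [lower] is
    the square function bound, in the range where the norm of the square function
    in L_oo, which is at most [C], cannot account for it. *)
Hypothesis upper : forall s, uniq s ->
  ('N[mu]_p%:E[EFin \o (fun t => \sum_(k <- s) f k t)%R] <=
   (C * Num.sqrt (size s)%:R)%:E)%E.
Hypothesis lower : forall s, uniq s -> B * C < Num.sqrt (size s)%:R ->
  ((Num.sqrt (size s)%:R)%:E <= B%:E *
    'N[mu]_p%:E[EFin \o (fun t => Num.sqrt (\sum_(k <- s) f k t ^+ 2))%R])%E.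

Let p0 : 0 < p. Proof. exact: lt_le_trans p1. Qed.
Let p1E : (1 <= p%:E)%E. Proof. by rewrite lee_fin. Qed.

Lemma sqrtn_powR_unbounded (b K : R) : 0 < b ->
  exists n0, forall n, (n0 <= n)%N -> K < Num.sqrt n%:R `^ b.
Proof.
move=> b0; pose a := (`|K| + 1) `^ (2 / b).
exists (Num.truncn a).+1 => n an.
have {}an : a < n%:R by apply: lt_le_trans (truncnS_gt _) _; rewrite ler_nat.
have a0 : 0 <= a by exact: powR_ge0.
rewrite -powR12_sqrt// -powRrM.
apply: (@lt_trans _ _ (`|K| + 1)); first by rewrite (le_lt_trans (ler_norm _))// ltrDl.
have -> : `|K| + 1 = a `^ (2^-1 * b).
  rewrite -powRrM (_ : _ * _ = 1); first by rewrite powRr1// addr_ge0.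
  by field; rewrite gt_eqF.
by apply: gt0_ltr_powR; rewrite ?nnegrE// mulr_gt0.
Qed.

Let Lnorm_f k : ('N[mu]_p%:E[EFin \o f k] <= C%:E)%E.
Proof.
have := @upper [:: k] isT; rewrite /= sqrtr1 mulr1; congr (_ <= _)%E.
by congr (Lnorm _ _ (_ \o _)); apply/funext => t; rewrite big_seq1.
Qed.

Let integral_f k : (\int[mu]_t (`|f k t| `^ p)%:E <= (C `^ p)%:E)%E.
Proof.
rewrite -Lnorm_poweR// -poweR_EFin; apply: gt0_ler_poweR;
  rewrite ?(ltW p0) ?in_itv/= ?leey ?andbT ?lee_fin ?(ltW C0)//.
by rewrite Lnorm_ge0.
Qed.

Let finf k : (\int[mu]_t (`|f k t| `^ p)%:E < +oo)%E.
Proof. exact: le_lt_trans (integral_f k) (ltry _). Qed.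

Let mpeak s := measurable_peak mf s.
Let mabs s := measurable_abs_sum mf s.
Let msq s : measurable_fun setT (fun t => Num.sqrt (\sum_(k <- s) f k t ^+ 2)).
Proof.
apply: (measurableT_comp (continuous_measurable_fun (@sqrt_continuous R))).
by apply: measurable_sum => k; exact: measurable_funX.
Qed.
Let mD s : measurable_fun setT (fun t => abs_sum (f^~ t) s - peak (f^~ t) s).
Proof. exact: measurable_funB. Qed.

Let Lnorm_sq_le s :
  ('N[mu]_p%:E[EFin \o (fun t => Num.sqrt (\sum_(k <- s) f k t ^+ 2))%R]
  <= 'N[mu]_p%:E[EFin \o (fun t => abs_sum (f^~ t) s)])%E.
Proof.
apply: le_Lnorm_ae => //; apply: nearW => t.
by rewrite !ger0_norm ?sqrtr_ge0 ?abs_sum_ge0// sqrt_sum_sq_le_abs_sum.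
Qed.

Let lower_abs s (a : R) : uniq s -> B * C < Num.sqrt (size s)%:R ->
  ('N[mu]_p%:E[EFin \o (fun t => abs_sum (f^~ t) s)] <= a%:E)%E ->
  Num.sqrt (size s)%:R <= B * a.
Proof.
move=> us sBC sa; rewrite -lee_fin EFinM; apply: le_trans (lower us sBC) _.
apply: lee_wpmul2l; first by rewrite lee_fin ltW.
exact: le_trans (Lnorm_sq_le s) sa.
Qed.

Let Lnorm_abs_le s (a : R) :
  ('N[mu]_p%:E[EFin \o (fun t => peak (f^~ t) s)] <= a%:E)%E ->
  ('N[mu]_p%:E[EFin \o (fun t => (abs_sum (f^~ t) s - peak (f^~ t) s)%R)] <= 1%:E)%E ->
  ('N[mu]_p%:E[EFin \o (fun t => abs_sum (f^~ t) s)] <= (a + 1)%:E)%E.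
Proof.
move=> sa s1.
have -> : (fun t => abs_sum (f^~ t) s) =
    (fun t => peak (f^~ t) s) \+ (fun t => abs_sum (f^~ t) s - peak (f^~ t) s).
  by apply/funext => t /=; rewrite addrC subrK.
by apply: le_trans (eminkowski mu (mpeak s) (mD s) p1E) _; rewrite EFinD leeD.
Qed.

(** With x = sqrt(n), a nearly disjoint family of size n would give
    x <= B (C x ^ (2 / p) + 1), where 2 / p < 1. *)
Lemma exponent_le2 : p <= 2.
Proof.
rewrite leNgt; apply/negP => p2.
have a0 : 0 < 1 - 2 / p by rewrite subr_gt0 ltr_pdivrMr// mul1r.
have [n0 n0P] := sqrtn_powR_unbounded (B * (C + 1)) a0.
have [n1 n1P] := sqrtn_powR_unbounded (B * C + 1) ltr01.
pose n := maxn n0 n1.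
have {n0P}n0P := n0P n (leq_maxl _ _); have {n1P}n1P := n1P n (leq_maxr _ _).
have inf : forall k0, exists2 k, (k0 <= k)%N & True by move=> k; exists k.
have [s [us sn _ sD _]] := almost_disjoint p1 mf finf f0 n ltr01 inf.
set x := Num.sqrt n%:R in n0P n1P *.
have x0 : 0 <= x by exact: sqrtr_ge0.
rewrite powRr1// in n1P.
have x1 : 1 <= x by have : 0 <= B * C by [rewrite mulr_ge0// ltW]; lra.
have xa : n%:R `^ p^-1 = x `^ (2 / p).
  by rewrite /x -powR12_sqrt// -powRrM mulrA mulVf// mul1r.
have xa1 : 1 <= x `^ (2 / p).
  by rewrite -[leLHS](powRr0 x); apply: ler_powR => //; rewrite divr_ge0// ltW.
have Npeak : ('N[mu]_p%:E[EFin \o (fun t => peak (f^~ t) s)] <= (x `^ (2 / p) * C)%:E)%E.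
  apply: Lnorm_le_integral => //; first by rewrite mulr_ge0 ?powR_ge0 ?ltW.
  rewrite powRM ?powR_ge0 ?(ltW C0)// -xa -powRrM mulVf ?gt_eqF// powRr1//.
  apply: (@le_trans _ _ (\int[mu]_t (\sum_(k <- s) (`|f k t| `^ p)%:E))%E).
    apply: ge0_le_integral => //.
    - by apply: measurable_powR_EFin; exact: measurableT_comp.
    - apply: emeasurable_sum => k; apply: measurable_powR_EFin.
      exact: measurableT_comp.
    - move=> t _; rewrite sumEFin lee_fin ger0_norm ?peak_ge0//.
      by apply: peak_powR_le; rewrite gt_eqF.
  have mfp k : measurable_fun setT (fun t => (`|f k t| `^ p)%:E).
    by apply: measurable_powR_EFin; exact: measurableT_comp.
  have fp0 k t : setT t -> (0 <= (`|f k t| `^ p)%:E)%E by rewrite lee_fin powR_ge0.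
  rewrite (ge0_integral_sum mu measurableT mfp fp0).
  apply: le_trans (lee_sum _ (fun k _ => integral_f k)) _.
  by rewrite sumEFin lee_fin big_const_seq count_predT sn iter_addr_0 mulr_natl.
have xle : x <= B * (x `^ (2 / p) * C + 1).
  by rewrite /x -sn; apply: lower_abs; rewrite ?sn// -/x; [lra|exact: Lnorm_abs_le].
have : x <= x `^ (2 / p) * (B * (C + 1)).
  apply: le_trans xle _; rewrite mulrCA ler_pM2l//.
  by rewrite mulrDr lerD2l mulr1.
rewrite leNgt => /negP; apply.
have xE : x = x `^ (2 / p) * x `^ (1 - 2 / p).
  rewrite -powRD; last by rewrite (gt_eqF (lt_le_trans ltr01 x1)) implybT.
  by rewrite addrC subrK powRr1.
by rewrite [ltRHS]xE ltr_pM2l// (lt_le_trans ltr01).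
Qed.

Lemma Lnorm_abs_sum s (a : R) : 0 <= a ->
  (forall k, k \in s -> ('N[mu]_p%:E[EFin \o f k] <= a%:E)%E) ->
  ('N[mu]_p%:E[EFin \o (fun t => abs_sum (f^~ t) s)] <= ((size s)%:R * a)%:E)%E.
Proof.
move=> a0; elim: s => [_|k s IH H].
  have -> : EFin \o (fun t => abs_sum (f^~ t) [::]) = cst 0%E.
    by apply/funext => t; rewrite /= /abs_sum big_nil.
  by rewrite Lnorm0 ?mul0r// gt_eqF.
have -> : (fun t => abs_sum (f^~ t) (k :: s)) =
    (fun t => `|f k t|) \+ (fun t => abs_sum (f^~ t) s).
  by apply/funext => t /=; rewrite abs_sum_cons.
have mk : measurable_fun setT (fun t => `|f k t|) by exact: measurableT_comp.
apply: le_trans (eminkowski mu mk (mabs s) p1E) _.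
have -> : (size (k :: s))%:R * a = a + (size s)%:R * a.
  by rewrite /= -natr1 mulrDl mul1r addrC.
rewrite EFinD; apply: leeD.
  apply: (le_trans _ (H k (mem_head _ _))).
  by apply: le_Lnorm_ae => //; apply: nearW => t; rewrite normr_id.
by apply: IH => i si; apply: H; rewrite inE si orbT.
Qed.

(** If the norms tended to 0, then n of the functions would have norms at most
    1 / n, and a square function of norm at most 1, whatever n is. *)
Lemma Lnorm_bounded_below : exists2 c : R, 0 < c &
  forall k0, exists2 k, (k0 <= k)%N & (c%:E <= \int[mu]_t (`|f k t| `^ p)%:E)%E.
Proof.
have [n0 n0P] := sqrtn_powR_unbounded (B * C + B) ltr01.
have {n0P} := n0P n0.+1 (leqnSn _); rewrite powRr1 ?sqrtr_ge0// => n0P.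
set n := n0.+1 in n0P; pose a : R := n%:R^-1.
have a0 : 0 < a by rewrite invr_gt0 ltr0n.
exists (a `^ p); first exact: powR_gt0.
move=> k0; apply: contrapT => /forall2NP H.
pose s := iota k0 n.
have sn : size s = n by rewrite size_iota.
have us : uniq s by exact: iota_uniq.
have : ('N[mu]_p%:E[EFin \o (fun t => abs_sum (f^~ t) s)] <= 1%:E)%E.
  rewrite -[1](@mulfV _ n%:R) ?pnatr_eq0// -sn; apply: Lnorm_abs_sum.
    by rewrite sn ltW.
  move=> k; rewrite mem_iota sn => /andP[k0k _].
  have [/negP//|/negP] := H k; rewrite -ltNge => /ltW Hk.
  by apply: Lnorm_le_integral => //; exact: ltW.
have BC0 : 0 < B * C by rewrite mulr_gt0.
have sBC : B * C < Num.sqrt (size s)%:R by rewrite sn (lt_trans _ n0P)// ltrDl.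
by move=> /(lower_abs us sBC); rewrite sn mulr1 leNgt (lt_trans _ n0P)// ltrDr.
Qed.

(** With x = sqrt(n), a nearly disjoint family of size n would give
    c x ^ 2 <= (C x + 1) ^ p + 1, where p < 2. *)
Lemma exponent_ge2 : 2 <= p.
Proof.
rewrite leNgt; apply/negP => p2.
have [c c0 inf] := Lnorm_bounded_below.
have a0 : 0 < 2 - p by lra.
have [n0 n0P] := sqrtn_powR_unbounded (((C + 1) `^ p + 1) / c) a0.
have [n1 n1P] := sqrtn_powR_unbounded 1 ltr01.
pose n := maxn n0 n1.
have {n0P}n0P := n0P n (leq_maxl _ _); have {n1P}n1P := n1P n (leq_maxr _ _).
have [s [us sn sP sD sI]] := almost_disjoint p1 mf finf f0 n ltr01 inf.
set x := Num.sqrt n%:R in n0P n1P *.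
have x0 : 0 <= x by exact: sqrtr_ge0.
rewrite powRr1// in n1P.
have Npeak : ('N[mu]_p%:E[EFin \o (fun t => peak (f^~ t) s)] <= (C * x + 1)%:E)%E.
  pose S t := \sum_(k <- s) f k t.
  have mS : measurable_fun setT S by exact: measurable_sum.
  pose Sn t := `|S t|; pose D t := abs_sum (f^~ t) s - peak (f^~ t) s.
  have mSn : measurable_fun setT Sn by exact: measurableT_comp.
  apply: (@le_trans _ _ ('N[mu]_p%:E[EFin \o (Sn \+ D)%R])%E).
    apply: le_Lnorm_ae => //.
      exact: measurable_funD mSn (mD s).
    apply: nearW => t /=; rewrite ger0_norm ?peak_ge0// ger0_norm.
      exact: peak_le_norm_sum.
    by rewrite addr_ge0 ?/Sn// /D subr_ge0 peak_le_abs_sum.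
  apply: le_trans (eminkowski mu mSn (mD s) p1E) _.
  rewrite EFinD; apply: leeD; last exact: sD.
  apply: le_trans (_ : _ <= 'N[mu]_p%:E[EFin \o S])%E _.
    by apply: le_Lnorm_ae => //; apply: nearW => t; rewrite normr_id.
  by rewrite /x -sn; exact: upper.
have Ipeak : (\int[mu]_t (peak (f^~ t) s `^ p)%:E <= ((C * x + 1) `^ p)%:E)%E.
  have -> : (\int[mu]_t (peak (f^~ t) s `^ p)%:E =
             \int[mu]_t (`|peak (f^~ t) s| `^ p)%:E)%E.
    by apply: eq_integral => t _; rewrite ger0_norm ?peak_ge0.
  have Cx : 0 <= C * x + 1 by rewrite addr_ge0// mulr_ge0// ltW.
  rewrite -Lnorm_poweR// -poweR_EFin; apply: gt0_ler_poweR;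
    by rewrite ?(ltW p0) ?in_itv/= ?leey ?andbT ?lee_fin// Lnorm_ge0.
have : (n%:R * c <= (C * x + 1) `^ p + 1).
  rewrite -lee_fin EFinD; apply: (le_trans _ (leeD Ipeak (lexx _))).
  apply: (le_trans _ sI); rewrite -sn mulr_natl -iter_addr_0.
  rewrite -(count_predT s) -big_const_seq.
  by rewrite -sumEFin big_seq [leRHS]big_seq; apply: lee_sum => k /sP.
have xp1 : 1 <= x `^ p.
  by rewrite -[leLHS](powRr0 x); apply: ler_powR; rewrite ltW.
have : (C * x + 1) `^ p + 1 <= x `^ p * ((C + 1) `^ p + 1).
  rewrite mulrDr mulr1 lerD// -powRM//; last by rewrite addr_ge0// ltW.
  apply: ge0_ler_powR; rewrite ?nnegrE ?(ltW p0)//.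
  - by rewrite addr_ge0// mulr_ge0// ltW.
  - by rewrite mulr_ge0// addr_ge0// ltW.
  - by rewrite mulrDr mulr1 mulrC lerD2l ltW.
move=> h /le_trans/(_ h); rewrite leNgt => /negP; apply.
have -> : n%:R = x `^ p * x `^ (2 - p).
  rewrite -powRD; last by rewrite (gt_eqF (lt_trans ltr01 n1P)) implybT.
  by rewrite addrC subrK powR_mulrn// sqr_sqrtr.
rewrite -mulrA ltr_pM2l; last by exact: lt_le_trans xp1.
by rewrite -ltr_pdivrMr.
Qed.

End dichotomy.

(** * Linear bounds from continuity, and inequalities for finite sums *)

Section bounded_on.
Context (R : realType) (X Y : normedModType R).

Lemma within_continuous_bound (M : set X) (S : X -> Y) : M 0 ->
  (forall a x, M x -> M (a *: x)) ->
  (forall a x, M x -> S (a *: x) = a *: S x) ->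
  {within M, continuous S} ->
  exists2 C : R, 0 < C & forall x, M x -> `|S x| <= C * `|x|.
Proof.
move=> M0 MZ SZ /subspace_continuousP/(_ 0 M0) cS.
have S0 : S 0 = 0 by have := SZ 0 0 M0; rewrite !scale0r.
have {cS} : S x @[x --> within M (nbhs 0)] --> 0 by rewrite -[X in _ --> X]S0.
move=> /cvgr0Pnorm_lt /(_ 1 ltr01).
rewrite near_withinE => /nbhs_norm0P[r /= r0 Hr].
exists (2 / r) => [|x Mx]; first by rewrite divr_gt0.
have [->|x0] := eqVneq x 0.
  by rewrite S0 !normr0 mulr0.
have nx : 0 < `|x| by rewrite normr_gt0.
pose a := r / 2 / `|x|; have a0 : 0 < a by rewrite !divr_gt0.
have /Hr/(_ (MZ a x Mx)) : `|a *: x| < r.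
  rewrite normrZ gtr0_norm// /a divfK ?gt_eqF//.
  by rewrite ltr_pdivrMr// ltr_pMr// ltr1n.
rewrite SZ// normrZ gtr0_norm// -ltr_pdivlMl// mulr1 => /ltW/le_trans; apply.
rewrite (_ : a^-1 = 2 / r * `|x|)// /a.
by field; rewrite !gt_eqF.
Qed.

End bounded_on.

Section sums.
Context (R : realType).

Lemma ler_sum_subseq (F : nat -> R) (s1 s2 : seq nat) : uniq s1 -> uniq s2 ->
  {subset s1 <= s2} -> (forall k, 0 <= F k) ->
  \sum_(k <- s1) F k <= \sum_(k <- s2) F k.
Proof.
move=> u1 u2 s12 F0; have us : uniq [seq k <- s2 | k \in s1] by exact: filter_uniq.
rewrite (perm_big [seq k <- s2 | k \in s1]); last first.
  apply: uniq_perm => // k; rewrite mem_filter.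
  by apply/idP/andP => [ks|[]//]; split => //; exact: s12.
rewrite big_filter [leRHS](bigID (mem s1)) /= lerDl.
by apply: sumr_ge0 => k _.
Qed.

Lemma sqr_sum_le (I : finType) (a : I -> R) :
  (\sum_i a i) ^+ 2 <= #|I|%:R * \sum_i a i ^+ 2.
Proof.
rewrite expr2 mulr_suml.
apply: (@le_trans _ _ (\sum_i \sum_j (a i ^+ 2 + a j ^+ 2) / 2)).
  apply: ler_sum => i _; rewrite mulr_sumr; apply: ler_sum => j _.
  by have := sqr_ge0 (a i - a j); rewrite sqrrB; lra.
set q := \sum_i a i ^+ 2.
rewrite (eq_bigr (fun i => (#|I|%:R * a i ^+ 2 + q) / 2)); last first.
  by move=> i _; rewrite -mulr_suml big_split /= sumr_const mulr_natl.
rewrite -mulr_suml big_split /= -mulr_sumr sumr_const -/q -[q *+ _]mulr_natl.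
by lra.
Qed.

End sums.

(** * Square-summable sequences *)

Section l2_basis.
Context (R : realType).
Implicit Types (a : nat -> R) (u : l2 R).

Lemma Lnorm_counting2 a :
  ('N[@counting nat R]_2[EFin \o a] `^ 2 = \sum_(0 <= k <oo) (a k ^+ 2)%:E)%E.
Proof.
rewrite Lnorm_counting// -poweRrM mulVf// poweRe1; last first.
  by apply: nneseries_ge0 => k _ _; exact: poweR_ge0.
apply: eq_eseriesr => k _; by rewrite /= -[2]/(2%:R) powR_mulrn// real_normK// num_real.
Qed.

Lemma Lnorm_counting2_le a M : 0 <= M ->
  (forall n, \sum_(k < n) a k ^+ 2 <= M ^+ 2) ->
  ('N[@counting nat R]_2[EFin \o a] <= M%:E)%E.
Proof.
move=> M0 H; rewrite Lnorm_counting//.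
have -> : M%:E = ((M ^+ 2)%:E `^ 2^-1)%E.
  by rewrite poweR_EFin -powR_mulrn// -powRrM mulfV// powRr1.
apply: gt0_ler_poweR; rewrite ?invr_ge0 ?in_itv/= ?leey ?andbT ?lee_fin ?sqr_ge0//.
  by apply: nneseries_ge0 => k _ _; rewrite lee_fin powR_ge0.
apply: lime_le; first by apply: is_cvg_nneseries => k _ _; rewrite lee_fin powR_ge0.
apply: nearW => n; rewrite big_mkord.
rewrite (eq_bigr (fun k : 'I_n => (a k ^+ 2)%:E)).
  by rewrite sumEFin lee_fin; exact: H.
by move=> k _; rewrite /= -[2]/(2%:R) powR_mulrn// real_normK// num_real.
Qed.

Lemma sum_sq_le_l2_norm u n : \sum_(k < n) u k ^+ 2 <= `|u| ^+ 2.
Proof.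
have fu : ('N[@counting nat R]_2[EFin \o u] < +oo)%E by exact: Lfunction_finite.
rewrite -lee_fin -sumEFin.
have -> : ((`|u| ^+ 2)%:E = 'N[@counting nat R]_2[EFin \o u] `^ 2)%E.
  rewrite -[`|u|]/(fine 'N[@counting nat R]_2[EFin \o u]%E).
  have sqrE (x : R) : 0 <= x -> ((x ^+ 2)%:E = x%:E `^ 2)%E.
    by move=> x0; rewrite poweR_EFin -[2]/(2%:R) powR_mulrn.
  rewrite sqrE; last by apply: fine_ge0; exact: Lnorm_ge0.
  congr (_ `^ _)%E; apply: fineK; rewrite ge0_fin_numE//; exact: Lnorm_ge0.
rewrite Lnorm_counting2 -(big_mkord xpredT (fun k => (u k ^+ 2)%:E)).
by apply: nneseries_lim_ge => k _ _; rewrite lee_fin sqr_ge0.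
Qed.

Lemma sum_sq_seq_le_l2_norm u s : uniq s -> \sum_(k <- s) u k ^+ 2 <= `|u| ^+ 2.
Proof.
move=> us; apply: le_trans (sum_sq_le_l2_norm u (\max_(k <- s) k).+1).
rewrite -(big_mkord xpredT (fun k => u k ^+ 2)).
apply: ler_sum_subseq => // [|k ks|k]; last exact: sqr_ge0.
  exact: iota_uniq.
by rewrite mem_index_iota /= ltnS (@leq_bigmax_seq _ s xpredT id).
Qed.

Lemma Lfun_counting2 a M : 0 <= M -> (forall n, \sum_(k < n) a k ^+ 2 <= M ^+ 2) ->
  a \in Lfun (@counting nat R) 2.
Proof.
move=> M0 H; rewrite inE; apply/andP; split; apply: mem_set => //=.
exact: le_lt_trans (Lnorm_counting2_le M0 H) (ltry _).
Qed.

Lemma l2_norm_le u M : 0 <= M -> (forall n, \sum_(k < n) u k ^+ 2 <= M ^+ 2) ->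
  `|u| <= M.
Proof.
have fu : ('N[@counting nat R]_2[EFin \o u] < +oo)%E by exact: Lfunction_finite.
move=> M0 H; rewrite -lee_fin.
rewrite -[`|u|]/(fine 'N[@counting nat R]_2[EFin \o u]%E) fineK.
  exact: Lnorm_counting2_le.
by rewrite ge0_fin_numE//; exact: Lnorm_ge0.
Qed.

Lemma l2_unit_subproof i :
  (fun k => (k == i)%:R : R) \in Lfun (@counting nat R) 2.
Proof.
apply: (@Lfun_counting2 _ 1) => // n; rewrite expr1n.
apply: (@le_trans _ _ (\sum_(k <- [:: i]) 1)); last by rewrite big_seq1.
apply: (@le_trans _ _ (\sum_(k <- [seq k <- iota 0 n | k == i]) 1)); last first.
  apply: ler_sum_subseq => //; first by rewrite filter_uniq// iota_uniq.
  by move=> k; rewrite mem_filter inE => /andP[].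
rewrite big_filter [leRHS]big_mkcond /=.
rewrite -[X in iota 0 X]subn0 -/(index_iota 0 n) big_mkord.
by apply: ler_sum => k _; case: eqP; rewrite ?expr1n ?expr0n.
Qed.

Definition l2_unit i : l2 R := Lfun_Sub (lee1n 2) (l2_unit_subproof i).

Lemma l2_unitE i k : (l2_unit i : nat -> R) k = (k == i)%:R.
Proof. by []. Qed.

Lemma l2_sumE (J : Type) (r : seq J) (c : J -> R) (v : J -> l2 R) k :
  ((\sum_(j <- r) c j *: v j : l2 R) : nat -> R) k = \sum_(j <- r) c j * v j k.
Proof. by elim: r => [|j r IH]; rewrite ?big_nil// !big_cons -IH. Qed.

Lemma l2_unit_comb_norm s (c : nat -> R) : uniq s ->
  `|\sum_(k <- s) c k *: l2_unit k| <= Num.sqrt (\sum_(k <- s) c k ^+ 2).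
Proof.
move=> us; apply: l2_norm_le; first exact: sqrtr_ge0.
have s0 r : 0 <= \sum_(k <- r) c k ^+ 2 by apply: sumr_ge0 => k _; exact: sqr_ge0.
move=> n; rewrite sqr_sqrtr//.
apply: (@le_trans _ _ (\sum_(k <- [seq k <- iota 0 n | k \in s]) c k ^+ 2)); last first.
  apply: ler_sum_subseq => //; [|by move=> k; rewrite mem_filter => /andP[]|].
    by rewrite filter_uniq// iota_uniq.
  by move=> k; exact: sqr_ge0.
rewrite big_filter [leRHS]big_mkcond /=.
rewrite -[X in iota 0 X]subn0 -/(index_iota 0 n) big_mkord.
apply: ler_sum => k _; rewrite l2_sumE.
case: ifPn => [ks|ks].
  rewrite (bigD1_seq (k : nat))//= eqxx mulr1 big1 ?addr0// => j jk.
  by rewrite eq_sym (negbTE jk) mulr0.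
rewrite big_seq big1 ?expr0n// => j js; rewrite l2_unitE.
by case: eqP => [kj|]; rewrite ?mulr0//; rewrite kj js in ks.
Qed.

End l2_basis.

(** * Functions and classes in the intersection space *)

Section class_of_function.
Context d (T : measurableType d) (R : realType) (mu : {measure set T -> \bar R}).
Variables (p : R) (p1 : 1 <= p).
Local Notation X := (Lp_cap_Loo mu p1).
Local Notation L0 := {mfun_ mu, T >-> R}.
Implicit Types (f g h : T -> R) (x y : X).

Definition fn x : T -> R := (x : L0) : T -> R.

Let p1E : (1 <= p%:E)%E. Proof. by rewrite lee_fin. Qed.
Let oo1 : (1 <= +oo :> \bar R)%E. Proof. exact: leey. Qed.

Definition LpLoo_fun : set (T -> R) := [set f | [/\ measurable_fun setT f,
  finite_norm mu p%:E f & finite_norm mu +oo%E f]].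

Lemma measurable_fn x : measurable_fun setT (fn x).
Proof. exact: ae_class_measurable. Qed.

Lemma fn_LpLoo x : LpLoo_fun (fn x).
Proof. by have [? ?] := Lp_cap_Loo_finite x; split => //; exact: measurable_fn. Qed.

Lemma fn_inj x y : {ae mu, forall t, fn x t = fn y t} -> x = y.
Proof. by move=> xy; apply/val_inj/ae_class_eq; apply: filterS xy. Qed.

Lemma fn_lin a x y : {ae mu, forall t, fn (a *: x + y) t = a * fn x t + fn y t}.
Proof.
have := ae_classD (a *: (x : L0)) (y : L0); have := ae_classZ a (x : L0).
apply: filterS2 => t /(_ Logic.I) /= e1 /(_ Logic.I) /=.
by rewrite e1 => e2; exact: e2.
Qed.

Lemma fn0 : {ae mu, forall t, fn 0 t = 0}.
Proof. by apply: filterS (ae_class0 mu) => t /(_ Logic.I). Qed.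

Lemma fn_sum (J : Type) (r : seq J) (c : J -> R) (x : J -> X) :
  {ae mu, forall t, fn (\sum_(j <- r) c j *: x j) t = \sum_(j <- r) c j * fn (x j) t}.
Proof.
elim: r => [|j r IH].
  by rewrite big_nil; apply: filterS fn0 => t ->; rewrite big_nil.
rewrite big_cons; near=> t.
rewrite (near (fn_lin (c j) (x j) (\sum_(i <- r) c i *: x i)) t)//.
by rewrite (near IH t)// big_cons.
Unshelve. all: by end_near.
Qed.

Lemma norm_fnE x : `|x| =
  Num.max (fine 'N[mu]_p%:E[EFin \o fn x])%E (fine 'N[mu]_+oo[EFin \o fn x])%E.
Proof. by []. Qed.

Lemma Lp_norm_le x : ('N[mu]_p%:E[EFin \o fn x] <= `|x|%:E)%E.
Proof.
have [_ xp _] := fn_LpLoo x.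
by rewrite -[leLHS]fineK ?finite_norm_fin_num// lee_fin norm_fnE le_max lexx.
Qed.

(** If the whole space is null, the supremum norm is 0 by convention, but then
    everything holds almost everywhere. *)
Lemma ae_le_norm x : {ae mu, forall t, `|fn x t| <= `|x|}.
Proof.
have [mT0|mT] := eqVneq (mu setT) 0%E; first by exists setT; split.
have [_ _ xoo] := fn_LpLoo x.
have : (ess_sup mu (abse \o (EFin \o fn x)) <= `|x|%:E)%E.
  have -> : ess_sup mu (abse \o (EFin \o fn x)) = 'N[mu]_+oo[EFin \o fn x]%E.
    by rewrite unlock /Lnorm ifT// lt0e mT measure_ge0.
  by rewrite -[leLHS]fineK ?finite_norm_fin_num// lee_fin norm_fnE le_max lexx orbT.
by move=> /ess_supP; apply: filterS => t; rewrite /= lee_fin.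
Qed.

(** The class of [f] when [f] has finite norms, and 0 otherwise; as a total
    function it lets the functionals on X act on plain functions. *)
Definition cls f : X := xget 0 [set x : X | {ae mu, forall t, fn x t = f t}].

Lemma fn_cls f : LpLoo_fun f -> {ae mu, forall t, fn (cls f) t = f t}.
Proof.
move=> [mf fp foo].
suff : exists x : X, {ae mu, forall t, fn x t = f t} by move=> /(xgetPex 0).
pose F : {mfun T >-> R} := mfun_Sub (mem_set mf : f \in mfun).
have FE : {ae mu, forall t, (\pi_(L0)%qT F : L0) t = f t}.
  by apply: filterS (ae_repr_pi mu F) => t /(_ Logic.I).
have H q : (1 <= q)%E -> finite_norm mu q f -> finite_norm mu q (\pi_(L0)%qT F : L0).
  move=> q1; rewrite /finite_norm (@eq_ae_Lnorm _ _ _ mu q q1 _ f)//.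
    by apply: filterS FE => t e _.
have FP : (\pi_(L0)%qT F : L0) \in Lp_cap_Loo_pred p1.
  by rewrite inE; split; exact: H.
by exists (LpLoo FP).
Qed.

Lemma clsK x : cls (fn x) = x.
Proof. exact: fn_inj (fn_cls (fn_LpLoo x)). Qed.

Lemma LpLoo_fun_solid f g : measurable_fun setT f ->
  (forall t, `|f t| <= `|g t|) -> LpLoo_fun g -> LpLoo_fun f.
Proof.
move=> mf fg [mg gp goo].
have {}fg : {ae mu, forall t, `|f t| <= `|g t|} by exact: nearW.
split => //; first exact: le_lt_trans (le_Lnorm_ae p1E mf mg fg) gp.
exact: le_lt_trans (le_Lnorm_ae oo1 mf mg fg) goo.
Qed.

Lemma LpLoo_fun_lin a f g : LpLoo_fun f -> LpLoo_fun g -> LpLoo_fun (a *: f + g).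
Proof.
move=> [mf fp foo] [mg gp goo].
have H q : (1 <= q)%E -> finite_norm mu q f -> finite_norm mu q g ->
    finite_norm mu q (a *: f + g).
  move=> q1 fq gq.
  have fL : f \in Lfun mu q by rewrite inE; apply/andP; split; apply: mem_set.
  have gL : g \in Lfun mu q by rewrite inE; apply/andP; split; apply: mem_set.
  have := (Lfun_submod_closed mu q1).2 a f g fL gL.
  by rewrite inE => /andP[_]; rewrite inE.
split; [|exact: H|exact: H].
by apply: measurable_funD => //; exact: measurable_funM.
Qed.

Lemma LpLoo_fun0 : LpLoo_fun 0.
Proof.
have H q : (1 <= q)%E -> finite_norm mu q (0 : T -> R).
  move=> q1; rewrite /finite_norm -[EFin \o _]/(cst 0%E) Lnorm0//.
  by rewrite gt_eqF// (lt_le_trans _ q1).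
by split; [exact: measurable_cst|exact: H|exact: H].
Qed.

Lemma cls_lin a f g : LpLoo_fun f -> LpLoo_fun g ->
  cls (a *: f + g) = a *: cls f + cls g.
Proof.
move=> Vf Vg; apply: fn_inj; near=> t.
rewrite (near (fn_cls (LpLoo_fun_lin a Vf Vg)) t)//.
rewrite (near (fn_lin a (cls f) (cls g)) t)//.
by rewrite (near (fn_cls Vf) t)// (near (fn_cls Vg) t).
Unshelve. all: by end_near. Qed.

Lemma norm_clsE f : LpLoo_fun f -> `|cls f| =
  Num.max (fine 'N[mu]_p%:E[EFin \o f])%E (fine 'N[mu]_+oo[EFin \o f])%E.
Proof.
move=> Vf; rewrite norm_fnE; have [mf _ _] := Vf.
have H q : (1 <= q)%E -> 'N[mu]_q[EFin \o fn (cls f)]%E = 'N[mu]_q[EFin \o f]%E.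
  move=> q1; apply: (eq_ae_Lnorm q1 (measurable_fn _) mf).
  by apply: filterS (fn_cls Vf) => t e _.
by rewrite !H.
Qed.

Lemma norm_cls_le f g : LpLoo_fun f -> LpLoo_fun g ->
  (forall t, `|f t| <= `|g t|) -> `|cls f| <= `|cls g|.
Proof.
move=> Vf Vg fg; rewrite !norm_clsE//; have [mf fp foo] := Vf; have [mg gp goo] := Vg.
have H q : (1 <= q)%E -> finite_norm mu q f -> finite_norm mu q g ->
    fine 'N[mu]_q[EFin \o f]%E <= fine 'N[mu]_q[EFin \o g]%E.
  by move=> q1 fq gq; apply: fine_le; rewrite ?ge0_fin_numE ?Lnorm_ge0//;
    apply: le_Lnorm_ae => //; exact: nearW.
rewrite ge_max !le_max; apply/andP; split; apply/orP; [left|right]; exact: H.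
Qed.

End class_of_function.

(** * Complemented Hilbert spaces over an arbitrary measure *)

Section hilbert_retract.
Context d (T : measurableType d) (R : realType) (mu : {measure set T -> \bar R}).
Variables (p : R) (p1 : 1 <= p).
Local Notation X := (Lp_cap_Loo mu p1).
Variables (Tl : {linear l2 R -> X}) (U : X -> l2 R) (C b : R).
Hypothesis U_lin : forall a x y, U (a *: x + y) = a *: U x + U y.
Hypothesis TK : cancel Tl U.
Hypotheses (C0 : 0 < C) (b0 : 0 < b).
Hypothesis T_bound : forall u, `|Tl u| <= C * `|u|.
Hypothesis U_bound : forall x, `|U x| <= b * `|x|.

Let f k : T -> R := fn (Tl (l2_unit R k)).
Let mf k : measurable_fun setT (f k). Proof. exact: measurable_fn. Qed.

Let f_sum (s : seq nat) (c : nat -> R) : {ae mu, forall t,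
  fn (Tl (\sum_(k <- s) c k *: l2_unit R k)) t = \sum_(k <- s) c k * f k t}.
Proof.
rewrite linear_sum; under eq_bigr do rewrite linearZ.
exact: fn_sum.
Qed.

Let f_sum_norm (s : seq nat) (c : nat -> R) : uniq s ->
  `|Tl (\sum_(k <- s) c k *: l2_unit R k)| <= C * Num.sqrt (\sum_(k <- s) c k ^+ 2).
Proof.
move=> us; apply: le_trans (T_bound _) _; rewrite ler_pM2l//.
exact: l2_unit_comb_norm.
Qed.

Let f_sq : {ae mu, forall t n, \sum_(i < n) f i t ^+ 2 <= C ^+ 2}.
Proof.
apply: ae_sum_sq_bound => [|n z]; first exact: ltW.
pose c k : R := if insub k is Some i then (z i)%:~R else 0.
have cE (i : 'I_n) : c i = (z i)%:~R by rewrite /c valK.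
have us : uniq (iota 0 n) by exact: iota_uniq.
pose x := Tl (\sum_(k <- iota 0 n) c k *: l2_unit R k).
apply: filterS2 (f_sum (iota 0 n) c) (ae_le_norm x) => t E N.
have /(_ us) := @f_sum_norm (iota 0 n) c.
have iE (F : nat -> R) : \sum_(k <- iota 0 n) F k = \sum_(i < n) F i.
  by rewrite -[n in LHS]subn0 -/(index_iota 0 n) big_mkord.
rewrite !iE => /(le_trans N); rewrite E iE.
by under eq_bigr do rewrite cE; under [in leRHS]eq_bigr do rewrite cE.
Qed.

(** The terms of a convergent series tend to 0. *)
Let f_cvg0 : {ae mu, forall t, f ^~ t @ \oo --> 0}.
Proof.
apply: filterS f_sq => t H.
have : f k t ^+ 2 @[k --> \oo] --> 0.
  apply: cvg_series_cvg_0; apply: nondecreasing_is_cvgn.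
    by apply: nondecreasing_series => k _ _; exact: sqr_ge0.
  exists (C ^+ 2) => _ [n _ <-]; rewrite /series /= big_mkord; exact: H.
move=> h; apply/norm_cvg0P.
have : Num.sqrt (f k t ^+ 2) @[k --> \oo] --> Num.sqrt 0.
  by apply: continuous_cvg => //; exact: sqrt_continuous.
by rewrite sqrtr0; under eq_fun do rewrite sqrtr_sqr.
Qed.

Let f_upper s : uniq s ->
  ('N[mu]_p%:E[EFin \o (fun t => \sum_(k <- s) f k t)%R] <=
   (C * Num.sqrt (size s)%:R)%:E)%E.
Proof.
move=> us; pose x := Tl (\sum_(k <- s) 1 *: l2_unit R k).
have -> : 'N[mu]_p%:E[EFin \o (fun t => \sum_(k <- s) f k t)%R]%E =
    'N[mu]_p%:E[EFin \o fn x]%E.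
  apply: eq_ae_Lnorm; first by rewrite lee_fin.
  - exact: measurable_sum.
  - exact: measurable_fn.
  - apply: filterS (f_sum s (fun=> 1)) => t /= e _; rewrite /x e.
    by apply: eq_bigr => k _; rewrite mul1r.
apply: le_trans (Lp_norm_le x) _; rewrite lee_fin.
apply: le_trans (f_sum_norm (fun=> 1) us) _; rewrite ler_pM2l//.
by under eq_bigr do rewrite expr1n; rewrite big_const_seq count_predT iter_addr_0.
Qed.

(** [square_function_bound] is applied to the coordinates of [U] at the indices in
    [s]. By Cauchy-Schwarz they are jointly bounded by sqrt(n) times the norm of
    [U], so that n <= 2 sqrt(n) b |g|. *)
Let f_lower s : uniq s -> 2 * b * C < Num.sqrt (size s)%:R ->
  ((Num.sqrt (size s)%:R)%:E <= (2 * b)%:E *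
    'N[mu]_p%:E[EFin \o (fun t => Num.sqrt (\sum_(k <- s) f k t ^+ 2))%R])%E.
Proof.
move=> us; set n := size s; set r := Num.sqrt n%:R => rC.
pose g t := Num.sqrt (\sum_(k <- s) f k t ^+ 2).
have s0 t : 0 <= \sum_(k <- s) f k t ^+ 2 by apply: sumr_ge0 => k _; exact: sqr_ge0.
have g0 t : 0 <= g t by exact: sqrtr_ge0.
have mg : measurable_fun setT g.
  apply: (measurableT_comp (continuous_measurable_fun (@sqrt_continuous R))).
  by apply: measurable_sum => k; exact: measurable_funX.
have Vf k : LpLoo_fun mu p (f k) by exact: fn_LpLoo.
pose kk (i : 'I_n) := nth 0%N s i.
have sE (V : nmodType) (F : nat -> V) : \sum_(k <- s) F k = \sum_(i < n) F (kk i).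
  by rewrite (big_nth 0%N) big_mkord.
have gC : {ae mu, forall t, `|g t| <= C}.
  apply: filterS f_sq => t H; rewrite ger0_norm//.
  rewrite -[leRHS]gtr0_norm// -sqrtr_sqr ler_sqrt ?sqr_ge0//.
  apply: le_trans (H (\max_(k <- s) k).+1).
  rewrite -(big_mkord xpredT (fun k => f k t ^+ 2)).
  apply: ler_sum_subseq => // [|k ks|k]; last exact: sqr_ge0.
    exact: iota_uniq.
  by rewrite mem_index_iota /= ltnS (@leq_bigmax_seq _ s xpredT id).
have Vg : LpLoo_fun mu p g.
  have Va : LpLoo_fun mu p (\sum_(k <- s) (1 : R) *: (fun t => `|f k t|)).
    elim: (s) => [|k s' IH]; first by rewrite big_nil; exact: LpLoo_fun0.
    rewrite big_cons; apply: LpLoo_fun_lin => //.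
    apply: (@LpLoo_fun_solid _ _ _ _ _ p1 _ (f k)) => //; first exact: measurableT_comp.
    by move=> u; rewrite normr_id.
  apply: (LpLoo_fun_solid p1 mg _ Va) => t.
  have -> : (\sum_(k <- s) (1 : R) *: (fun t => `|f k t|)) t = abs_sum (f^~ t) s.
    by rewrite fct_sumE /abs_sum; apply: eq_bigr => k _; rewrite scale1r.
  by rewrite !ger0_norm ?abs_sum_ge0//; exact: sqrt_sum_sq_le_abs_sum.
pose y (i : 'I_n) (h : T -> R) : R := U (cls mu p1 h) (kk i).
pose D := r * (b * `|cls mu p1 g|).
have key : \sum_i y i (f (kk i)) <= 2 * D.
  apply: (@square_function_bound R 'I_n T (LpLoo_fun mu p) y g D) => //.
  - exact: LpLoo_fun0.
  - exact: LpLoo_fun_lin.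
  - move=> h Vh; apply: (LpLoo_fun_solid p1 _ _ Vg).
      have [mh _ _] := Vh; apply: measurable_maxr; first exact: measurableT_comp.
      exact: measurable_minr.
    by move=> t; rewrite [leRHS]ger0_norm// normr_clamp.
  - by move=> i a h1 h2 V1 V2; rewrite /y cls_lin// U_lin.
  - move=> e h Vh hg.
    rewrite -(@ler_pXn2r _ 2)// ?nnegrE//; last first.
      by rewrite /D !mulr_ge0 ?sqrtr_ge0 ?(ltW b0).
    rewrite real_normK ?num_real//.
    apply: le_trans (sqr_sum_le _) _.
    rewrite card_ord exprMn sqr_sqrtr// ler_wpM2l//.
    apply: (@le_trans _ _ (`|U (cls mu p1 h)| ^+ 2)).
      apply: le_trans (sum_sq_seq_le_l2_norm (U (cls mu p1 h)) us).
      rewrite sE; apply: ler_sum => i _.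
      by rewrite exprMn expr2 sgnM mul1r.
    rewrite lerXn2r// ?nnegrE ?mulr_ge0// ?(ltW b0)//.
    apply: le_trans (U_bound _) _; rewrite ler_pM2l//.
    by apply: (norm_cls_le p1 Vh Vg) => u; rewrite [leRHS]ger0_norm.
  - split=> [i|t]; first exact: Vf.
    by rewrite sqr_sqrtr// sE.
have yE : \sum_i y i (f (kk i)) = n%:R.
  under eq_bigr do rewrite /y /f clsK TK l2_unitE eqxx.
  by rewrite sumr_const card_ord.
have n0 : 0 <= r by exact: sqrtr_ge0.
have rp : 0 < r by apply: le_lt_trans rC; rewrite !mulr_ge0// ltW.
have rle : r <= 2 * b * `|cls mu p1 g|.
  rewrite -(ler_pM2l rp) -expr2 sqr_sqrtr// -yE; apply: le_trans key _.
  by rewrite /D; lra.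
have [mg' gp goo] := Vg.
have goo' : fine 'N[mu]_+oo[EFin \o g]%E <= C.
  rewrite -lee_fin fineK; last by rewrite ge0_fin_numE// Lnorm_ge0.
  rewrite unlock /Lnorm; case: ifP => _; last by rewrite lee_fin ltW.
  by apply/ess_supP; apply: filterS gC => t; rewrite /= lee_fin.
rewrite -[X in (_ <= _ * X)%E](@fineK _ 'N[mu]_p%:E[EFin \o g]%E); last first.
  by rewrite ge0_fin_numE// Lnorm_ge0.
rewrite -EFinM lee_fin; apply: (le_trans rle); rewrite ler_pM2l ?mulr_gt0//.
rewrite norm_clsE// in rle *.
rewrite ge_max lexx /= leNgt; apply/negP => ac.
rewrite max_r ?(ltW ac)// in rle.
have b20 : 0 <= 2 * b by rewrite mulr_ge0 ?ltW.
by have := lt_le_trans rC (le_trans rle (ler_wpM2l b20 goo')); rewrite ltxx.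
Qed.

Theorem hilbert_retract_exponent : p = 2.
Proof.
have b20 : 0 < 2 * b by rewrite mulr_gt0.
apply/eqP; rewrite eq_le.
rewrite (exponent_le2 p1 mf f_cvg0 b20 C0 f_upper f_lower).
by rewrite (exponent_ge2 p1 mf f_cvg0 b20 C0 f_upper f_lower).
Qed.

End hilbert_retract.

Section from_complemented.
Context d (T : measurableType d) (R : realType) (mu : {measure set T -> \bar R}).
Variables (p : R) (p1 : 1 <= p).
Local Notation X := (Lp_cap_Loo mu p1).

(** Following the projection by the inverse of the isomorphism makes l_2 a retract
    of X, to which [hilbert_retract_exponent] applies. *)
Theorem complemented_hilbert_exponent (M : set X) :
  complemented M -> isomorphic_to M (l2 R) -> p = 2.
Proof.
move=> [_ [P [[CP P_bound] PP PM]]] [Tl [S [Tcont TM TK Scont]]].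
have MT x : M x -> exists u, Tl u = x by rewrite -TM => -[u _ <-]; exists u.
have TM' u : M (Tl u) by rewrite -TM; exists u.
have STE x : M x -> Tl (S x) = x by move=> /MT[u <-]; rewrite TK.
have MP x : M (P x) by rewrite -PM; exists x.
have [C C0 CH] : exists2 C : R, 0 < C & forall u, `|Tl u| <= C * `|u|.
  have [| | | |C C0 H] := @within_continuous_bound R (l2 R) X setT Tl => //.
  - by move=> a x _; rewrite linearZ.
  - exact: continuous_subspaceT.
  by exists C => // u; exact: H.
have [b b0 bH] : exists2 b : R, 0 < b & forall x, M x -> `|S x| <= b * `|x|.
  apply: within_continuous_bound => //.
  - by rewrite -(linear0 Tl).
  - by move=> a x /MT[u <-]; rewrite -linearZ.
  - by move=> a x /MT[u <-]; rewrite -linearZ !TK.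
pose U x := S (P x).
have U_lin a x y : U (a *: x + y) = a *: U x + U y.
  rewrite /U -[RHS]TK; congr S.
  by rewrite linearP [RHS]linearP !STE.
have UTK : cancel Tl U.
  move=> u; rewrite /U; have [x _ xu] : range P (Tl u) by rewrite PM.
  by rewrite -xu PP xu TK.
pose K := b * Num.max CP 1.
have K0 : 0 < K by rewrite mulr_gt0// lt_max ltr01 orbT.
apply: (hilbert_retract_exponent U_lin UTK C0 K0 CH) => x.
apply: le_trans (bH _ (MP x)) _; rewrite /K -mulrA ler_pM2l//.
by apply: le_trans (P_bound x) _; rewrite ler_wpM2r// le_max lexx.
Qed.

End from_complemented.

(** * The complemented Hilbert space for exponent 2 *)

Section partition_into_unit_cells.
Context d (T : measurableType d) (R : realType) (mu : {measure set T -> \bar R}).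
(** [k t] is the index of the cell that contains [t]. *)
Variable k : T -> nat.
Hypothesis mk : measurable_fun setT k.
Let E n : set T := k @^-1` [set n].
Hypothesis muE : forall n, mu (E n) = 1%E.
Variable two1 : 1 <= 2 :> R.
Local Notation X := (Lp_cap_Loo mu two1).
Implicit Types (x : X) (u : l2 R).

Let mE n : measurable (E n).
Proof. by rewrite /E -[_ @^-1` _]setTI; exact: mk. Qed.

Let bigcupE : \bigcup_n E n = setT.
Proof. by apply/seteqP; split => // t _; exists (k t). Qed.

Let trivE : trivIset setT E.
Proof.
apply/trivIsetP => i j _ _ ij; apply/seteqP; split => // t [/= ki kj].
by move: ij; rewrite -ki -kj eqxx.
Qed.

Let mfn x n : measurable_fun (E n) (fn x).
Proof. exact: measurable_funS (measurable_fn x). Qed.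

Lemma integral_cells (f : T -> R) : measurable_fun setT f ->
  (\int[mu]_t (f t ^+ 2)%:E = \sum_(0 <= n <oo) \int[mu]_(t in E n) (f t ^+ 2)%:E)%E.
Proof.
move=> mf; rewrite -bigcupE ge0_integral_bigcup//.
- by rewrite bigcupE; apply/measurable_EFinP; exact: measurable_funX.
- by move=> t _; rewrite lee_fin sqr_ge0.
Qed.

Lemma Lnorm2_sq (f : T -> R) :
  ('N[mu]_2%:E[EFin \o f] `^ 2 = \int[mu]_t (f t ^+ 2)%:E)%E.
Proof.
rewrite Lnorm_poweR//; apply: eq_integral => t _.
by rewrite -[2]/(2%:R) powR_mulrn// real_normK// num_real.
Qed.

Lemma Lnorm2_le (f : T -> R) M : 0 <= M ->
  (\int[mu]_t (f t ^+ 2)%:E <= (M ^+ 2)%:E)%E -> ('N[mu]_2%:E[EFin \o f] <= M%:E)%E.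
Proof.
move=> M0 H; apply: Lnorm_le_integral => //.
have -> : (\int[mu]_t (`|f t| `^ 2)%:E = \int[mu]_t (f t ^+ 2)%:E)%E.
  apply: eq_integral => t _.
  by rewrite -[2]/(2%:R) powR_mulrn// real_normK// num_real.
by rewrite -[2]/(2%:R) powR_mulrn.
Qed.

Lemma integral_sq_le_norm x : (\int[mu]_t (fn x t ^+ 2)%:E <= (`|x| ^+ 2)%:E)%E.
Proof.
rewrite -Lnorm2_sq -powR_mulrn// -[2%:R]/2 -poweR_EFin.
apply: gt0_ler_poweR; rewrite ?in_itv/= ?leey ?andbT ?lee_fin ?Lnorm_ge0//.
exact: Lp_norm_le.
Qed.

Lemma cell_integrable x n : mu.-integrable (E n) (EFin \o fn x).
Proof.
apply/integrableP; split; first by apply/measurable_EFinP.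
apply: (@le_lt_trans _ _ (\int[mu]_(t in E n) (`|x|%:E))%E); last first.
  by rewrite integral_cst// muE mule1 ltry.
apply: ae_ge0_le_integral => //.
- by apply: measurableT_comp => //; apply/measurable_EFinP.
- by apply: filterS (ae_le_norm x) => t h _; rewrite /= lee_fin.
Qed.

Definition cell_mean x n : R := (\int[mu]_(t in E n) fn x t)%R.

Lemma cell_mean_lin a x y n :
  cell_mean (a *: x + y) n = a * cell_mean x n + cell_mean y n.
Proof.
rewrite /cell_mean -RintegralZl//; last exact: cell_integrable.
rewrite -RintegralD//; last 2 first.
- rewrite (_ : EFin \o _ = (fun t => a%:E * (EFin \o fn x) t)%E)//.
  by apply: integrableZl => //; exact: cell_integrable.
- exact: cell_integrable.
congr fine; apply: ae_eq_integral => //.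
- by apply/measurable_EFinP.
- by apply/measurable_EFinP; apply: measurable_funD => //; exact: measurable_funM.
- by apply: filterS (fn_lin a x y) => t -> _.
Qed.

(** Integrate 2 m f <= f ^ 2 + m ^ 2 over a cell of measure 1, where m is the mean
    of f. *)
Lemma sqr_cell_mean_le x n :
  ((cell_mean x n ^+ 2)%:E <= \int[mu]_(t in E n) (fn x t ^+ 2)%:E)%E.
Proof.
set m := cell_mean x n.
have msq : measurable_fun (E n) (fun t => (fn x t ^+ 2)%:E).
  by apply/measurable_EFinP; exact: measurable_funX.
have sq0 t : E n t -> (0 <= (fn x t ^+ 2)%:E)%E by move=> _; rewrite lee_fin sqr_ge0.
have isq : mu.-integrable (E n) (fun t => (fn x t ^+ 2)%:E).
  apply/integrableP; split => //.
  have -> : (\int[mu]_(t in E n) `|(fn x t ^+ 2)%:E| =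
      \int[mu]_(t in E n) (fn x t ^+ 2)%:E)%E.
    by apply: eq_integral => t _; rewrite gee0_abs// lee_fin sqr_ge0.
  apply: le_lt_trans (ltry (`|x| ^+ 2)); apply: le_trans (integral_sq_le_norm x).
  apply: ge0_subset_integral => //; last by move=> t _; rewrite lee_fin sqr_ge0.
  by apply/measurable_EFinP; apply: measurable_funX; exact: measurable_fn.
have icst : mu.-integrable (E n) (cst (m ^+ 2)%:E).
  apply/integrableP; split; first exact: measurable_cst.
  rewrite (_ : (fun t => _) = cst (m ^+ 2)%:E).
    by rewrite integral_cst// muE mule1 ltry.
  by apply/funext => t; rewrite /= ger0_norm ?sqr_ge0.
have mE' : (\int[mu]_(t in E n) (fn x t)%:E = m%:E)%E.
  rewrite /m /cell_mean /Rintegral fineK//.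
  by apply: integrable_fin_num => //; exact: cell_integrable.
have : (\int[mu]_(t in E n) ((2 * m)%:E * (fn x t)%:E) <=
        \int[mu]_(t in E n) ((fn x t ^+ 2)%:E + (m ^+ 2)%:E))%E.
  apply: le_integral => //.
  - by apply: integrableZl => //; exact: cell_integrable.
  - exact: integrableD isq icst.
  - move=> t _; rewrite -EFinM -EFinD lee_fin.
    by have := sqr_ge0 (fn x t - m); rewrite sqrrB; lra.
rewrite integralZl//; last exact: cell_integrable.
rewrite mE' ge0_integralD//; last by move=> t _; rewrite lee_fin sqr_ge0.
rewrite integral_cst// muE mule1.
have fin : (\int[mu]_(t in E n) (fn x t ^+ 2)%:E)%E \is a fin_num.
  exact: integrable_fin_num.
rewrite -(fineK fin) -EFinM -EFinD !lee_fin; lra.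
Qed.

Lemma cell_mean_sq_sum x N : \sum_(n < N) cell_mean x n ^+ 2 <= `|x| ^+ 2.
Proof.
rewrite -lee_fin -sumEFin; apply: le_trans (integral_sq_le_norm x).
rewrite integral_cells; last exact: measurable_fn.
apply: (@le_trans _ _ (\sum_(0 <= n < N) \int[mu]_(t in E n) (fn x t ^+ 2)%:E)%E).
  by rewrite big_mkord; apply: lee_sum => n _; exact: sqr_cell_mean_le.
apply: nneseries_lim_ge => n _ _; apply: integral_ge0 => t _.
by rewrite lee_fin sqr_ge0.
Qed.

Definition cell_coef x : l2 R :=
  Lfun_Sub (lee1n 2) (Lfun_counting2 (normr_ge0 x) (cell_mean_sq_sum x)).

Lemma cell_coef_lin a x y : cell_coef (a *: x + y) = a *: cell_coef x + cell_coef y.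
Proof. by apply/LfuneqP => n; exact: cell_mean_lin. Qed.

Lemma cell_coef_norm x : `|cell_coef x| <= `|x|.
Proof. by apply: l2_norm_le => // N; exact: cell_mean_sq_sum. Qed.

Lemma step_sq_integral u : (\int[mu]_t (u (k t) ^+ 2)%:E <= (`|u| ^+ 2)%:E)%E.
Proof.
rewrite integral_cells; last exact: measurableT_comp.
apply: lime_le.
  apply: is_cvg_nneseries => n _ _; apply: integral_ge0 => t _.
  by rewrite lee_fin sqr_ge0.
apply: nearW => N; apply: (@le_trans _ _ (\sum_(n < N) (u n ^+ 2)%:E)%E); last first.
  by rewrite sumEFin lee_fin sum_sq_le_l2_norm.
rewrite big_mkord; apply: lee_sum => n _.
have -> : (\int[mu]_(t in E n) (u (k t) ^+ 2)%:E = \int[mu]_(t in E n) (u n ^+ 2)%:E)%E.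
  by apply: eq_integral => t /set_mem <-.
by rewrite integral_cst// muE mule1.
Qed.

Lemma abs_coord_le u n : `|u n| <= `|u|.
Proof.
rewrite -(@ler_pXn2r _ 2)// ?nnegrE// real_normK ?num_real//.
by have := @sum_sq_seq_le_l2_norm R u [:: n] isT; rewrite big_seq1.
Qed.


Lemma step_Lp u : ('N[mu]_2%:E[EFin \o (u \o k)] <= `|u|%:E)%E.
Proof. by apply: Lnorm2_le => //; exact: step_sq_integral. Qed.

Lemma step_Loo u : ('N[mu]_+oo[EFin \o (u \o k)] <= `|u|%:E)%E.
Proof.
rewrite unlock /Lnorm; case: ifP => _; last by rewrite lee_fin.
by apply/ess_supP/nearW => t; rewrite /= lee_fin abs_coord_le.
Qed.

Lemma step_LpLoo u : LpLoo_fun mu 2 (u \o k).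
Proof.
split; first exact: measurableT_comp.
- exact: le_lt_trans (step_Lp u) (ltry _).
- exact: le_lt_trans (step_Loo u) (ltry _).
Qed.

Definition step u : X := cls mu two1 (u \o k).

Lemma step_lin a u v : step (a *: u + v) = a *: step u + step v.
Proof. by rewrite /step -cls_lin//; exact: step_LpLoo. Qed.

Lemma step_norm u : `|step u| <= `|u|.
Proof.
rewrite norm_clsE; last exact: step_LpLoo.
have F (z : \bar R) : (0 <= z)%E -> (z <= `|u|%:E)%E -> fine z <= `|u|.
  by case: z => [r| |]//=; rewrite lee_fin.
by rewrite ge_max !F ?Lnorm_ge0 ?step_Lp ?step_Loo.
Qed.

Lemma stepK : cancel step cell_coef.
Proof.
move=> u; apply/LfuneqP => n /=.
rewrite -[LHS]/(fine (\int[mu]_(t in E n) (fn (step u) t)%:E)%E).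
have -> : (\int[mu]_(t in E n) (fn (step u) t)%:E = \int[mu]_(t in E n) (u n)%:E)%E.
  apply: ae_eq_integral => //; first by apply/measurable_EFinP.
  by apply: filterS (fn_cls two1 (step_LpLoo u)) => t -> /= <-.
by rewrite integral_cst// muE mule1.
Qed.

Theorem complemented_hilbert_exists :
  exists M : set X, complemented M /\ isomorphic_to M (l2 R).
Proof.
pose TL : {linear l2 R -> X} :=
  HB.pack step (GRing.isLinear.Build R (l2 R) X *:%R step step_lin).
pose SL : {linear X -> l2 R} :=
  HB.pack cell_coef (GRing.isLinear.Build R X (l2 R) *:%R cell_coef cell_coef_lin).
have bcont (V W : normedModType R) (f : {linear V -> W}) :
    (forall v, `|f v| <= `|v|) -> continuous f.
  move=> H v; apply/cvgrPdist_lt => e e0; near=> w.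
  rewrite -linearB; apply: le_lt_trans (H _) _; near: w.
  exact: cvgr_dist_lt cvg_id _ e0.
pose PL : {linear X -> X} := TL \o SL.
have TLK : cancel TL SL by exact: stepK.
have Pid x : PL (PL x) = PL x by exact (f_equal step (stepK (cell_coef x))).
exists (range TL); split; last first.
  exists TL, SL; split => //.
  - by apply: bcont; exact: step_norm.
  - by apply: continuous_subspaceT; apply: bcont; exact: cell_coef_norm.
have rP : range PL = range TL.
  apply/seteqP; split => [_ [x _ <-]|_ [u _ <-]]; first by exists (SL x).
  by exists (TL u) => //; exact (f_equal step (stepK u)).
have Pn x : `|PL x| <= `|x| by exact: le_trans (step_norm _) (cell_coef_norm _).
split; last by exists PL; split => //; exists 1 => x; rewrite mul1r.
split.
  split=> [|a x y]; first by rewrite inE; exists 0 => //; rewrite linear0.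
  rewrite !inE => -[u _ <-] [v _ <-]; exists (a *: u + v) => //.
  by rewrite linearP.
have -> : range TL = (fun x => PL x - x) @^-1` [set 0].
  rewrite -rP; apply/seteqP; split => [_ [x _ <-]|x /= /eqP].
    by change (PL (PL x) - PL x = 0); rewrite Pid subrr.
  by rewrite subr_eq0 => /eqP <-; exists x.
apply: preimage_closed; last first.
  by apply: accessible_closed_set1; apply: hausdorff_accessible; exact: norm_hausdorff.
move=> x _; apply: continuousB; [exact: bcont|exact: cvg_id].
Unshelve. all: by end_near. Qed.

End partition_into_unit_cells.

(** * The half-line *)

Section lebesgue_cells.
Variable R : realType.

Definition unit_cell (t : R) : nat := Num.truncn t.

Definition preim_cell n : interval R :=
  Interval (if n is 0%N then -oo%O else BLeft n%:R) (BLeft n.+1%:R).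

Lemma unit_cell_preimage n : unit_cell @^-1` [set n] = [set` preim_cell n].
Proof.
rewrite /unit_cell; apply/seteqP; case: n => [|n]; split => t /=; rewrite in_itv /=.
- by move=> /eqP; rewrite -leqn0 leqNgt truncn_gt0 -ltNge.
- by rewrite ltNge -truncn_gt0 -leqNgt leqn0 => /eqP.
- move=> tn; have t1 : 1 <= t by rewrite -truncn_gt0 tn.
  by rewrite -truncn_eq ?tn// (le_trans _ t1).
- move=> tn; apply/eqP; rewrite truncn_eq//.
  by move: tn => /andP[+ _]; exact: le_trans.
Qed.

Lemma measurable_unit_cell : measurable_fun setT
  (unit_cell : caratheodory_type ((wlength (@idfun R))^*)%mu -> nat).
Proof.
move=> _ Y _; rewrite setTI.
have -> : unit_cell @^-1` Y = \bigcup_(n in Y) unit_cell @^-1` [set n].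
  by apply/seteqP; split => [t Yt|t [n Yn /= tn]]; [exists (unit_cell t)|rewrite /= tn].
apply: bigcup_measurable => n _; rewrite unit_cell_preimage.
by apply: sub_caratheodory; exact: measurable_itv.
Qed.

(** The cell of index 0 contains all negative reals, which are null for the
    measure. *)
Lemma lebesgue_unit_cell n : lebesgue_Rpos R (unit_cell @^-1` [set n]) = 1%E.
Proof.
rewrite /lebesgue_Rpos /mrestr unit_cell_preimage.
have -> : [set` preim_cell n] `&` `]0, +oo[%classic =
    [set` Interval (BSide (n != 0%N) n%:R) (BLeft n.+1%:R)] :> set R.
  apply/seteqP; case: n => [|n]; split => t /=; rewrite !in_itv /= ?andbT.
  - by move=> [-> ->].
  - by move=> /andP[-> ->].
  - by move=> [-> _].
  - by move=> tn; split => //; move: tn => /andP[+ _]; exact: lt_le_trans.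
rewrite -[completed_lebesgue_measure _]/(lebesgue_measure _) lebesgue_measure_itv /=.
rewrite lte_fin ltr_nat ltnSn -EFinB -natr1 addrC addKr//.
Qed.

End lebesgue_cells.

Theorem theorem4 (R : realType) (p : R) (p1 : 1 <= p) :
  (exists M : set (Lp_cap_Loo (lebesgue_Rpos R) p1),
     complemented M /\ isomorphic_to M (l2 R)) <-> p = 2.
Proof.
split=> [[M [cM iM]]|p2]; first exact: complemented_hilbert_exponent cM iM.
subst p.
exact (@complemented_hilbert_exists _ _ R (lebesgue_Rpos R) (@unit_cell R)
  (@measurable_unit_cell R) (@lebesgue_unit_cell R) p1).
Qed.
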